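(* Assume that $E$ is separable and that for all $t>0$ the operator $Q_t$ is the covariance operator of a centred Gaussian Borel measure $\mu_t$ on $E$. Then the Ornstein-Uhlenbeck semigroup $P$ is strongly continuous on $C_b(E)$ in its mixed topology.
   Context: $E$ is a real Banach space with dual $E^*$; $S=\{S(t)\}_{t\ge0}$ is a $C_0$-semigroup of bounded linear operators on $E$ with adjoint operators $S^*(t)$ on $E^*$. $H$ is a real Hilbert space with a continuous injective linear map $i:H\to E$, and $Q:=i\circ i^*\in\mathcal L(E^*,E)$ ($H$ being identified with its dual). For $t>0$, $Q_t x^*:=\int_0^t S(s)QS^*(s)x^*\,ds$ for $x^*\in E^*$. The Ornstein-Uhlenbeck semigroup $P=\{P(t)\}_{t\ge0}$ is $P(t)f(x)=\int_E f(S(t)x+y)\,d\mu_t(y)$ ($\mu_0=\delta_0$); it maps the space $C_b(E)$ of bounded continuous functions on $E$ into itself. The mixed topology $\tau_{\rm mixed}$ on $C_b(E)$ is the finest locally convex topology that agrees on every norm-bounded set (for the supremum norm) with the topology of uniform convergence on compact sets. A sequence $(f_n)$ in $C_b(E)$ converges to $f\in C_b(E)$ in $\tau_{\rm mixed}$ if and only if $\sup_n\|f_n\|_\infty<\infty$ and $f_n\to f$ uniformly on compact subsets of $E$. Strong continuity means that for every $f\in C_b(E)$ the map $t\mapsto P(t)f$ is continuous from $[0,\infty)$ into $(C_b(E),\tau_{\rm mixed})$. *)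

(* Defs.v *)
From HB Require Import structures.
From mathcomp Require Import all_boot all_order all_algebra.
From mathcomp Require Import all_classical all_reals all_analysis.
From mathcomp Require Import measurable_realfun.

Set Implicit Arguments.
Unset Strict Implicit.
Unset Printing Implicit Defensive.

Import Order.TTheory GRing.Theory Num.Theory.
Import numFieldNormedType.Exports.

Local Open Scope classical_set_scope.
Local Open Scope ring_scope.

HB.structure Definition LinearContinuous (K : numFieldType)
    (E F : normedModType K) :=
  {f of @GRing.Linear K E F *:%R f & @Continuous E F f}.

Notation "{ 'lc' E '->' F }" := (@LinearContinuous.type _ E F)
  (at level 0, E at level 98, F at level 99,
   format "{ 'lc'  E  ->  F }") : type_scope.

HB.instance Definition _ (K : numFieldType) (E F G : normedModType K)
    (f : {lc E -> F}) (g : {lc F -> G}) :=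
  @isContinuous.Build E G (g \o f)
    (fun x => continuous_comp (@cts_fun _ _ f x) (@cts_fun _ _ g (f x))).

(* The topological dual of E is {lc E -> R^o}; no topology on it is needed. *)
Definition adjoint (R : realType) (E F : normedModType R)
    (T : {lc E -> F}) (ys : {lc F -> R^o}) : {lc E -> R^o} :=
  [the {lc E -> R^o} of ys \o T].

Definition separable (T : topologicalType) :=
  exists2 D : set T, countable D & dense D.

Definition C0_semigroup (R : realType) (E : normedModType R)
    (S : R -> {lc E -> E}) :=
  [/\ forall x, S 0 x = x,
      forall s t x, 0 <= s -> 0 <= t -> S (s + t) x = S s (S t x) &
      forall x, S t x @[t --> 0^'+] --> x].

(* A complete H whose norm is induced by a real inner product ip is a real
   Hilbert space. *)
Definition hilbert_norm (R : realType) (H : normedModType R)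
    (ip : {dot H for idfun}) := forall h : H, ip h h = `|h| ^+ 2.

(* i^* with H identified with its dual; for complete H the Riesz theorem makes
   the set a singleton, so that the default value 0 is never used. *)
Definition hilbert_adjoint (R : realType) (H E : normedModType R)
    (ip : {dot H for idfun}) (i : {lc H -> E}) (xs : {lc E -> R^o}) : H :=
  xget 0 [set h : H | forall k, ip h k = xs (i k)].

Section bochner.
Context d (T : measurableType d) (R : realType) (E : normedModType R).
Variables (mu : {measure set T -> \bar R}) (D : set T).

Definition simple_on (s : T -> E) :=
  [/\ finite_set (s @` D), forall v, measurable (D `&` s @^-1` [set v])
    & forall v, v != 0 -> (mu (D `&` s @^-1` [set v]) < +oo)%E].

Definition simple_integral (s : T -> E) : E :=
  \sum_(v \in s @` D) fine (mu (D `&` s @^-1` [set v])) *: v.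

(* The a.e. limit makes f strongly measurable on D, hence `|f - s n| is
   mu-a.e. equal to a measurable function. *)
Definition is_bochner_integral (f : T -> E) (v : E) :=
  exists s : nat -> T -> E,
    [/\ forall n, simple_on (s n),
        {ae mu, forall x, D x -> s n x @[n --> \oo] --> f x},
        (\int[mu]_(x in D) `|f x - s n x|%:E)%E @[n --> \oo] --> 0%E
      & simple_integral (s n) @[n --> \oo] --> v].

Definition bochner_integral (f : T -> E) : E :=
  xget 0 (is_bochner_integral f).

End bochner.

Definition Qop (R : realType) (H E : normedModType R)
    (ip : {dot H for idfun}) (i : {lc H -> E}) (xs : {lc E -> R^o}) : E :=
  i (hilbert_adjoint ip i xs).

Definition Qt (R : realType) (H E : normedModType R) (ip : {dot H for idfun})
    (i : {lc H -> E}) (S : R -> {lc E -> E}) (t : R) (xs : {lc E -> R^o}) : E :=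
  bochner_integral (@lebesgue_measure R) `[0, t]
    (fun s => S s (Qop ip i (adjoint (S s) xs))).

Definition borel (E : ptopologicalType) := g_sigma_algebraType (@open E).

Section gaussian.
Context (R : realType) (E : normedModType R).

(* Degenerate Gaussian laws are allowed; normal_prob 0 0 is not the Dirac mass
   in the library, whence the case distinction. *)
Definition centred_gaussian (mu : probability (borel E) R) :=
  forall xs : {lc E -> R^o}, exists2 sigma : R, 0 <= sigma &
    forall A : set (measurableTypeR R), measurable A ->
      pushforward mu (xs : borel E -> measurableTypeR R) A =
      if sigma == 0 then dirac (0 : measurableTypeR R) A
      else normal_prob 0 sigma A.

Definition is_covariance (mu : probability (borel E) R)
    (Q : {lc E -> R^o} -> E) :=
  forall xs ys : {lc E -> R^o},
    ys (Q xs) = \int[mu]_(x in [set: borel E]) (xs x * ys x : R).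

End gaussian.

Section bounded_continuous.
Context (R : realType) (E : normedModType R).

Definition bounded_continuous : {pred E -> R^o} :=
  fun f => `[< continuous f /\ bounded_fun f >].

(* C_b(E) *)
Record Cb := MkCb { Cb_val :> E -> R^o; Cb_prop : Cb_val \in bounded_continuous }.

HB.instance Definition _ := [isSub for Cb_val].
HB.instance Definition _ := [Choice of Cb by <:].

Lemma bounded_funE (f : E -> R^o) :
  bounded_fun f <-> exists M : R, forall x, `|f x| <= M.
Proof.
split=> [/pinfty_ex_gt0[M _ fM]|[M fM]]; first by exists M => x; exact: fM.
exists M; split; first exact: num_real.
by move=> N MN x _; exact: le_trans (fM x) (ltW MN).
Qed.

Lemma bounded_continuous_submod : submod_closed bounded_continuous.
Proof.
split.
  apply/asboolP; split; first by move=> x; exact: cvg_cst.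
  by apply/bounded_funE; exists 0 => x; rewrite normr0.
move=> a f g /asboolP[cf /bounded_funE[M fM]] /asboolP[cg /bounded_funE[N gN]].
apply/asboolP; split.
  by move=> x; apply: cvgD; [apply: cvgZl_tmp; exact: cf|exact: cg].
apply/bounded_funE; exists (`|a| * M + N) => x.
rewrite (le_trans (ler_normD _ _))// lerD// normrM.
by rewrite ler_wpM2l.
Qed.

HB.instance Definition _ := GRing.isSubmodClosed.Build R (E -> R^o)
  bounded_continuous bounded_continuous_submod.
HB.instance Definition _ := [SubChoice_isSubLmodule of Cb by <:].

Definition supnorm (f : Cb) : R := sup [set `|f x| | x in [set: E]].

Definition norm_bounded (B : set Cb) :=
  exists M : R, forall f, B f -> supnorm f <= M.

Definition compact_convergence : topologicalType :=
  initial_topology (fun f : Cb => (f : E -> R^o) : {family compact, E -> R^o}).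

(* Topological T is the type of topologies on the carrier T; the linear
   operations below are the pointwise ones of Cb. *)
Definition locally_convex_topology (tau : Topological Cb) :=
  let X := Topological.Pack tau in
  [/\ continuous ((fun f : Cb * Cb => f.1 + f.2) : X * X -> X),
      continuous ((fun z : R^o * Cb => z.1 *: z.2) : R^o * X -> X)
    & exists2 B : set_system X,
        (forall b, b \in B -> convex_set (b : set (convex_lmodType Cb))) & basis B].

Definition agree_on (T : Type) (tau tau' : Topological T) (B : set T) :=
  [set U `&` B | U in @open (Topological.Pack tau)] =
  [set U `&` B | U in @open (Topological.Pack tau')].

Definition mixed_candidate (tau : Topological Cb) :=
  locally_convex_topology tau /\
  forall B, norm_bounded B ->
    agree_on tau (Topological.class compact_convergence) B.

Definition mixed_topology : topologicalType :=
  sup_topology (fun tau : {tau | mixed_candidate tau} => sval tau).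

End bounded_continuous.


(* The supremum of all candidate topologies is itself a candidate, hence it is
   the finest one. *)
Section mixed_topology_theory.
Context (R : realType) (E : normedModType R).
Local Notation Cb := (Cb E).
Local Notation Co := (compact_convergence E).

Lemma compact_convergence_cvgP (F : set_system Cb) (f : Cb) : Filter F ->
  F --> (f : Co) <->
  forall (K : set E) (e : R), compact K -> 0 < e ->
    F [set g : Cb | forall x, K x -> `|f x - g x| < e].
Proof.
move=> FF; split=> [Ff K e cK e0|FK A].
  have : nbhs (f : Co) [set g : Cb | forall x, K x -> `|f x - g x| < e].
    apply: (@initial_continuous _ _ (fun f : Cb => (f : E -> R^o) :
      {family compact, E -> R^o}) f
      [set g : E -> R^o | forall x, K x -> `|f x - g x| < e]).
    exact: (fam_nbhs _ (entourage_ball (R^o : pseudoMetricType R) (PosNum e0)) cK).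
  exact: Ff.
rewrite /= nbhsE => -[_ [[U Uo <-] Uf] UA].
rewrite nbhs_filterE; apply: filterS UA _.
pose h : Cb -> {family compact, E -> R^o} := fun g => (g : E -> R^o).
suff : h @ F --> h f by apply; exact: open_nbhs_nbhs.
apply/fam_cvgP => K cK B /uniform_nbhs[D [entD DB]].
have [e /= e0 eD] : entourage_ (@ball R R^o) D by rewrite entourage_ballE.
change (F (h @^-1` B)); apply: filterS (FK K e cK e0) => g gK.
exact: (DB (g : E -> R^o) (fun x Kx => eD (f x, g x) (gK x Kx))).
Qed.

Lemma compact_convergence_nbhs (f : Cb) (K : set E) (e : R) :
  compact K -> 0 < e ->
  nbhs (f : Co) [set g : Cb | forall x, K x -> `|f x - g x| < e].
Proof.
by have /compact_convergence_cvgP := @cvg_id _ (nbhs (f : Co)); exact.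
Qed.

Lemma compact_convergence_candidate : mixed_candidate (Topological.class Co).
Proof.
split; last by [].
split.
- move=> [f g]; apply/compact_convergence_cvgP => K e cK e0.
  have e20 : 0 < e / 2 by rewrite divr_gt0.
  have nf : nbhs (f : Co) [set h : Cb | forall x, K x -> `|f x - h x| < e / 2].
    exact: compact_convergence_nbhs.
  have ng : nbhs (g : Co) [set h : Cb | forall x, K x -> `|g x - h x| < e / 2].
    exact: compact_convergence_nbhs.
  exists ([set h : Cb | forall x, K x -> `|f x - h x| < e / 2],
          [set h : Cb | forall x, K x -> `|g x - h x| < e / 2]) => //=.
  move=> [f' g'] [/= hf hg] x Kx /=.
  rewrite opprD addrACA (le_lt_trans (ler_normD _ _))// (splitr e).
  by rewrite ltrD// ?hf ?hg.
- move=> [a f]; apply/compact_convergence_cvgP => K e cK e0.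
  have [M fM] : exists M : R, forall x, `|f x| <= M.
    by have /asboolP[_ /bounded_funE] := Cb_prop f.
  have M0 : 0 <= M by apply: le_trans (fM 0).
  pose d := Num.min 1 (e / (2 * (`|a| + 1))).
  pose d' := e / (2 * (M + 1)).
  have d0 : 0 < d by rewrite lt_min ltr01 divr_gt0// mulr_gt0// ltr_wpDl.
  have d'0 : 0 < d' by rewrite divr_gt0// mulr_gt0// ltr_wpDl.
  have nf : nbhs (f : Co) [set h : Cb | forall x, K x -> `|f x - h x| < d].
    exact: compact_convergence_nbhs.
  exists ([set b : R^o | `|a - b| < d'],
          [set h : Cb | forall x, K x -> `|f x - h x| < d]) => //=.
    by split=> //=; exists d'.
  move=> [b h] [/= hb hf] x Kx /=.
  have -> : a * f x - b * h x = a * (f x - h x) + (a - b) * h x.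
    by rewrite mulrBr mulrBl addrA subrK.
  rewrite (le_lt_trans (ler_normD _ _))// (splitr e) !normrM.
  have fh := hf x Kx.
  apply: ler_ltD.
    apply: (@le_trans _ _ ((`|a| + 1) * (e / (2 * (`|a| + 1))))).
      apply: ler_pM => //; first by rewrite lerDl.
      by rewrite (le_trans (ltW fh))// /d ge_min lexx orbT.
    rewrite le_eqVlt; apply/orP; left; apply/eqP.
    by rewrite invfM mulrC -!mulrA mulVf ?mulr1// gt_eqF// ltr_wpDl.
  have hM : `|h x| <= M + 1.
    have -> : h x = f x - (f x - h x) by rewrite opprB addrC subrK.
    rewrite (le_trans (ler_normB _ _))// lerD ?fM//.
    by rewrite (le_trans (ltW fh))// /d ge_min lexx.
  apply: (@le_lt_trans _ _ (`|a - b| * (M + 1))); first by rewrite ler_wpM2l.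
  rewrite -ltr_pdivlMr; last by rewrite ltr_wpDl.
  by rewrite (lt_le_trans hb)// /d' invfM mulrA.
- exists [set U : set Cb | @open Co U /\ convex_set (U : set (convex_lmodType Cb))].
    by move=> b; rewrite inE => -[].
  split; first by move=> U [].
  move=> f; rewrite /=.
  have FF : Filter (filter_from [set U : set Cb | ((@open Co U) /\
      convex_set (U : set (convex_lmodType Cb))) /\ U f] id).
    apply: filter_from_filter.
      exists setT; split=> //; split; first exact: openT.
      by move=> x y l _ _; rewrite inE.
    move=> U V [[Uo Uc] Uf] [[Vo Vc] Vf]; exists (U `&` V) => //.
    split=> //; split; first exact: openI.
    move=> x y l; rewrite !inE => -[Ux Vx] [Uy Vy].
    by split; apply/set_mem; [apply: Uc|apply: Vc]; rewrite inE.
  apply/compact_convergence_cvgP => K e cK e0.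
  exists [set g : Cb | exists2 d, d < e & forall x, K x -> `|f x - g x| <= d].
    split; last first.
      by exists 0 => // x Kx; rewrite subrr normr0.
    split.
      rewrite openE => g [d de gd]; rewrite /interior.
      have ed0 : 0 < (e - d) / 2 by rewrite divr_gt0// subr_gt0.
      apply: filterS (compact_convergence_nbhs g cK ed0) => h gh.
      exists (d + (e - d) / 2); first by rewrite -ltrBrDl gtr_pMr ?subr_gt0// invf_lt1// ltr1n.
      move=> x Kx; rewrite -(subrKA (g x)).
      by rewrite (le_trans (ler_normD _ _))// lerD ?gd// ltW// gh.
    move=> g h l; rewrite !inE => -[d de gd] [d' d'e hd'].
    exists (Num.max d d'); first by rewrite gt_max de.
    move=> x Kx.
    set m := Num.max d d'; pose a : R := l%:num.
    have a0 : 0 <= a by rewrite /a ge0.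
    have a1 : 0 <= 1 - a by rewrite subr_ge0 /a le1.
    have gm : `|f x - (g : Cb) x| <= m by rewrite (le_trans (gd x Kx))// le_max lexx.
    have hm : `|f x - (h : Cb) x| <= m.
      by rewrite (le_trans (hd' x Kx))// le_max lexx orbT.
    rewrite (_ : _ - _ = a * (f x - (g : Cb) x) + (1 - a) * (f x - (h : Cb) x)).
      rewrite (le_trans (ler_normD _ _))// !normrM (ger0_norm a0) (ger0_norm a1).
      rewrite (le_trans (lerD (ler_wpM2l a0 gm) (ler_wpM2l a1 hm)))//.
      by rewrite -mulrDl addrC subrK mul1r.
    rewrite !mulrBr addrACA -mulrDl addrC [a + _]addrC subrK mul1r addrC -opprD.
    by [].
  by move=> g /= [d de gd] x Kx; exact: le_lt_trans (gd x Kx) de.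
Qed.

Local Notation Mx := (mixed_topology E).

Lemma mixed_topology_finest (tau : Topological Cb) : mixed_candidate tau ->
  @open (Topological.Pack tau) `<=` @open Mx.
Proof.
move=> ct U Uo; rewrite openE => f Uf.
apply: (proj1 (@cvg_sup _ _ _ (nbhs (f : Mx)) f _) cvg_id (exist _ tau ct)).
exact: (@open_nbhs_nbhs (Topological.Pack tau)).
Qed.

Lemma mixed_topology_candidate : mixed_candidate (Topological.class Mx).
Proof.
have idc (i : {tau : Topological Cb | mixed_candidate tau}) (f : Cb) :
    nbhs (f : Mx) --> (f : Topological.Pack (sval i)).
  exact: (proj1 (@cvg_sup _ _ _ (nbhs (f : Mx)) f _) cvg_id i).
split; first split.
- move=> [f g]; apply/cvg_sup => i A /= iA.
  have [[ci _ _] _] := svalP i.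
  have [[U V] /= [Uf Vg] UVA] := ci (f, g) A iA.
  by exists (U, V) => //=; split; [exact: (idc i f)|exact: (idc i g)].
- move=> [a f]; apply/cvg_sup => i A /= iA.
  have [[_ ci _] _] := svalP i.
  have [[U V] /= [Uf Vg] UVA] := ci (a, f) A iA.
  by exists (U, V) => //=; split => //; exact: (idc i f).
- exists [set U : set Cb | @open Mx U /\ convex_set (U : set (convex_lmodType Cb))].
    by move=> b; rewrite inE => -[].
  split; first by move=> U [].
  move=> f.
  have FF : Filter (filter_from [set U : set Cb | ((@open Mx U) /\
      convex_set (U : set (convex_lmodType Cb))) /\ U f] id).
    apply: filter_from_filter.
      exists setT; split=> //; split; first exact: openT.
      by move=> x y l _ _; rewrite inE.
    move=> U V [[Uo Uc] Uf] [[Vo Vc] Vf]; exists (U `&` V) => //.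
    split=> //; split; first exact: openI.
    move=> x y l; rewrite !inE => -[Ux Vx] [Uy Vy].
    by split; apply/set_mem; [apply: Uc|apply: Vc]; rewrite inE.
  apply/cvg_sup => i A iA.
  have [[_ _ [B Bc [Bo Bb]]] _] := svalP i.
  have [U [BU Uf] UA] := Bb f A iA.
  exists U => //; split => //; split; last by apply: Bc; rewrite inE.
  exact: mixed_topology_finest (svalP i) _ (Bo _ BU).
move=> B nB; apply/seteqP; split => [_ [U Uo <-]|_ [U Uo <-]]; last first.
  by exists U => //; exact: mixed_topology_finest compact_convergence_candidate _ Uo.
exists (\bigcup_(W in [set W : set Cb | @open Co W /\ W `&` B `<=` U]) W).
  by apply: bigcup_open => W [].
apply/seteqP; split=> [f [[W [_ WU] Wf] Bf]|f [Uf Bf]]; first by split=> //; exact: WU.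
split=> //.
have Ff : within B (nbhs (f : Co)) --> (f : Mx).
  apply/cvg_sup => i A; rewrite (@nbhsE (Topological.Pack (sval i))).
  move=> -[A' [A'o A'f] A'A].
  have [_ /(_ B nB) iB] := svalP i.
  have : [set V `&` B | V in @open Co] (A' `&` B) by rewrite -iB; exists A'.
  move=> [V Vo VA'].
  have [Vf _] : (V `&` B) f by rewrite VA'.
  apply: (@filterS _ (nbhs (f : Co)) _ V); last exact: open_nbhs_nbhs.
  by move=> g Vg Bg; apply: A'A; have [] : (A' `&` B) g by rewrite -VA'.
have : within B (nbhs (f : Co)) U by apply: Ff; exact: open_nbhs_nbhs.
rewrite /within /= nbhsE => -[W [Wo Wf] WU].
by exists W => //; split => // g [Wg Bg]; exact: WU.
Qed.

End mixed_topology_theory.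

Section ornstein_uhlenbeck.
Context (R : realType) (E : normedModType R).

Lemma continuous_borel_measurable (f : E -> R^o) : continuous f ->
  measurable_fun [set: borel E] (f : borel E -> measurableTypeR R).
Proof.
move=> /continuousP cf; apply: (measurability _ (RGenOpens.measurableE R)).
move=> _ [_ [a [b ->] <-]]; rewrite setTI; apply: sub_sigma_algebra.
exact/cf/interval_open.
Qed.

Variables (S : {lc E -> E}) (mu : probability (borel E) R) (f : Cb E).

Definition ou_fun (x : E) : R^o :=
  \int[mu]_(y in [set: borel E]) (f (S x + (y : E)) : R).

Let f_cont : continuous f. Proof. by have /asboolP[] := Cb_prop f. Qed.

Let f_bounded : exists M : R, forall x, `|f x| <= M.
Proof. by have /asboolP[_ /bounded_funE] := Cb_prop f. Qed.

Let shift_cont x : continuous (fun y => f (S x + y)).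
Proof.
move=> y; apply: continuous_comp; last exact: f_cont.
by apply: cvgD; [exact: cvg_cst|exact: cvg_id].
Qed.

Let shift_integrable x :
  mu.-integrable [set: borel E] (fun y : borel E => (f (S x + (y : E)))%:E).
Proof.
have [M fM] := f_bounded.
apply: (@le_integrable _ _ _ _ _ _ _ (EFin \o cst M)) => //.
- apply/measurable_EFinP; apply: continuous_borel_measurable; exact: shift_cont.
- move=> y _ /=; rewrite lee_fin (le_trans (fM _))//; exact: ler_norm.
- exact: finite_measure_integrable_cst.
Qed.

Lemma ou_fun_bounded_continuous : ou_fun \in @bounded_continuous R E.
Proof.
have [M fM] := f_bounded.
apply/asboolP; split; last first.
  apply/bounded_funE; exists M => x.
  apply: (le_trans (le_normr_Rintegral _ (shift_integrable x))) => //.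
  apply: (@le_trans _ _ (\int[mu]_(y in [set: borel E]) M)).
    apply: le_Rintegral => //.
      exact: (integrable_norm (shift_integrable x)).
    exact: finite_measure_integrable_cst.
  have mu1 : mu [set: borel E] = 1%E by exact: probability_setT.
  by rewrite Rintegral_cst// [X in fine X]mu1 mulr1.
move=> x; apply/cvgrPdist_lt => e e0; apply: contrapT => nx.
have /choice[u ue] n : exists y : E,
    `|x - y| < n.+1%:R^-1 /\ e <= `|ou_fun x - ou_fun y|.
  apply: contrapT => h; apply: nx.
  apply/nbhs_normP; exists n.+1%:R^-1 => /=; first by rewrite invr_gt0.
  move=> y /= xy; rewrite ltNge; apply/negP => ey; apply: h.
  by exists y.
have ux : u n @[n --> \oo] --> x.
  apply/cvgrPdist_lt => d d0.
  have := @near_infty_natSinv_lt R (PosNum d0).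
  apply: filterS => n /= nd; apply: lt_trans nd; exact: (ue n).1.
have : ou_fun (u n) @[n --> \oo] --> ou_fun x.
  apply: fine_cvg; rewrite fineK; last exact: integrable_fin_num.
  apply: (@dominated_cvg _ _ _ mu _ _ _ _ (EFin \o cst M)) => //=.
  - by move=> n; exact: (measurable_int mu (shift_integrable (u n))).
  - move=> y _; apply: cvg_EFin; first exact: nearW.
    apply: (@cvg_comp _ _ _ (fun n => S (u n) + (y : E)) f _ (nbhs (S x + (y : E)))).
      apply: cvgD; last exact: cvg_cst.
      apply: (cvg_comp _ _ ux); exact: (@cts_fun _ _ S).
    exact: f_cont.
  - exact: finite_measure_integrable_cst.
  - by move=> n y _; rewrite lee_fin.
move=> /cvgrPdist_lt /(_ _ e0)[N _ /(_ N (leqnn N))] /=.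
by rewrite ltNge (ue N).2.
Qed.

Definition ou_op : Cb E := MkCb ou_fun_bounded_continuous.

End ornstein_uhlenbeck.

Definition ou_semigroup (R : realType) (E : normedModType R)
    (S : R -> {lc E -> E}) (mu : R -> probability (borel E) R) (t : R) :
    Cb E -> Cb E :=
  ou_op (S t) (mu t).

(* Main.v *)
Require Import Defs.
From HB Require Import structures.
From mathcomp Require Import all_boot all_order all_algebra.
From mathcomp Require Import finmap.
From mathcomp Require Import all_classical all_reals all_analysis.
From mathcomp Require Import measurable_realfun.
From Stdlib Require Import Ring.

Set Implicit Arguments.
Unset Strict Implicit.
Unset Printing Implicit Defensive.

Import Order.TTheory GRing.Theory Num.Theory.
Import numFieldNormedType.Exports.

Local Open Scope classical_set_scope.
Local Open Scope ring_scope.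

(** Write X_t for a random vector of law mu t. Everything rests on the identity
    mu (s + h) = law of X_s + S(s) X'_h, with X_s and X'_h independent.  For a
    continuous linear form y, the law of y under mu t is the centred Gaussian law
    whose variance is y (Q_t y).  The Bochner integral defining Q_t commutes with
    y ([form_Qt]), and so this variance is the integral over [0, t] of the squared
    norms of i* S(s)* y; by the semigroup law it satisfies
    Q_(s + h) = Q_s + S(s) Q_h S(s)* ([variance_integralD]).  Centred Gaussian laws
    on the line add their variances under convolution
    ([gaussian_law_convolution]).  Therefore both sides of the identity have the
    same one-dimensional marginals, and on a separable space these determine a
    Borel probability measure ([marginals_determine]); the same argument shows
    that mu t is symmetric.

    Convolution and symmetry make the family mu s, 0 <= s <= T, uniformly tight
    ([uniformly_tight]): X_T = X_s + S(s) X'_(T - s) lies in a compact set K with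
    probability near 1, hence so does X_s + w for a suitable constant vector w, and
    by symmetry X_s then lies in (K - K) / 2.  Moreover the variance of y under
    mu h is at most C h, so that Chebyshev's inequality for finitely many forms,
    together with tightness, gives X_h -> 0 in probability as h -> 0
    ([concentration]).

    Consequently X_(s + h) = X_s + S(s) X'_h is close to X_s, which stays in a
    compact set with probability near 1, and a continuous function is uniformly
    continuous along a compact set: the expectation of f (z + X_t) is jointly
    continuous in t and z ([integral_translate_continuity]).  As (t, x) |-> S(t) x
    is jointly continuous too, so is (t, x) |-> P(t) f x, and joint continuity
    makes t |-> P(t) f continuous for uniform convergence on compact sets.  Since
    P(t) does not increase the supremum norm and the mixed topology coincides with
    that of compact convergence on norm-bounded sets, the curve is continuous in
    the mixed topology ([ou_semigroup_mixed_continuous]). *)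

(** * Ring identities over an abstract commutative ring *)

(** The tactic ring recognises the ring operations syntactically, whereas an
    operation of R reaches it under several instances of its algebraic structure.
    The copies below take the carrier as their only argument, and the goal is
    first rewritten into them. *)
Section ring_tactic.
Variable R : comNzRingType.
Definition sadd (x y : R) : R := x + y.
Definition smul (x y : R) : R := x * y.
Definition sopp (x : R) : R := - x.
Definition ssub (x y : R) : R := sadd x (sopp y).
Definition sone : R := 1.
Definition szero : R := 0.
Lemma sring_theory : ring_theory szero sone sadd smul ssub sopp (@eq R).
Proof.
split; rewrite /ssub /sadd /smul /sopp /szero /sone; move=> *.
- exact: add0r. - exact: addrC. - exact: addrA. - exact: mul1r.
- exact: mulrC. - exact: mulrA. - exact: mulrDl. - by []. - exact: subrr.
Qed.
End ring_tactic.

Definition sinv (R : unitRingType) (x : R) : R := x^-1.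

(** Powers become products and numerals become sums of ones; inverses are
    atoms. *)
Ltac sfold R := rewrite ?exprS ?expr0 ?expr1 ?mulr1 ?mulrS ?mulr0n ?addr0;
  repeat match goal with
  | |- context [@GRing.add ?V ?a ?b] => change (@GRing.add V a b) with (@sadd R a b)
  | |- context [@GRing.mul ?V ?a ?b] => change (@GRing.mul V a b) with (@smul R a b)
  | |- context [@GRing.opp ?V ?a] => change (@GRing.opp V a) with (@sopp R a)
  | |- context [@GRing.one ?V] => change (@GRing.one V) with (sone R)
  | |- context [@GRing.zero ?V] => change (@GRing.zero V) with (szero R)
  | |- context [@GRing.inv ?V ?a] => change (@GRing.inv V a) with (@sinv R a)
  end;
  match goal with |- @eq _ ?a ?b => change (@eq (GRing.ComNzRing.sort R) a b) end.

Ltac sring R := sfold R; ring.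

(** * Continuous linear maps and norming functionals *)

Section functional_analysis.
Context {R : realType}.

Lemma lc_of_linear_bound (E F : normedModType R) (f : E -> F) (M : R) :
  linear f -> (forall x, `|f x| <= M * `|x|) ->
  exists g : {lc E -> F}, forall x, g x = f x.
Proof.
move=> lf fM.
pose f1 : {linear E -> F} := HB.pack f (GRing.isLinear.Build _ _ _ _ _ lf).
have cf : continuous f1.
  apply/linear_bounded_continuous/linear_boundedP.
  exists M; split=> [|r Mr x]; first exact: num_real.
  by apply: le_trans (fM x) _; rewrite ler_wpM2r// ltW.
pose f2 : {lc E -> F} := HB.pack f (GRing.isLinear.Build _ _ _ _ _ lf)
  (isContinuous.Build E F f cf).
by exists f2.
Qed.

Lemma lc_continuous (E F : normedModType R) (T : {lc E -> F}) : continuous T.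
Proof. exact: cts_fun. Qed.

Lemma lc_bound (E F : normedModType R) (T : {lc E -> F}) :
  exists2 M : R, 0 < M & forall x, `|T x| <= M * `|x|.
Proof.
have /linear_bounded_continuous/linear_boundedP/pinfty_ex_gt0[M M0 TM] :=
  @lc_continuous _ _ T.
by exists M.
Qed.

Lemma lc_formZ (E : normedModType R) (y : {lc E -> R^o}) a x : y (a *: x) = a * y x.
Proof. exact: linearZ. Qed.

Section hahn_banach.
Variable E : normedModType R.

(** A linear form on a subspace is encoded by its graph, so that Zorn's lemma
    applies to sets ordered by inclusion; a dominated linear relation is
    automatically the graph of a function. *)
Let dominated_graph (G : set (E * R)) :=
  [/\ forall a x r y s, G (x, r) -> G (y, s) -> G (a *: x + y, a * r + s)
    & forall x r, G (x, r) -> r <= `|x|].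

(** The value c at x0 may be any number between all r - `|x - x0| and all
    `|x + x0| - r, for (x, r) in G; the former are at most the latter because G is
    linear and dominated. *)
Let dominated_graph_extend (G : set (E * R)) (x0 : E) : G (0, 0) ->
  dominated_graph G ->
  exists G', [/\ G `<=` G', dominated_graph G' & exists c, G' (x0, c)].
Proof.
move=> G0 [Glin Gle].
have sep x1 r1 x2 r2 : G (x1, r1) -> G (x2, r2) ->
    r1 - `|x1 - x0| <= `|x2 + x0| - r2.
  move=> G1 G2; rewrite lerBrDr addrAC lerBlDr.
  have := Gle _ _ (Glin 1 _ _ _ _ G1 G2); rewrite scale1r mul1r => /le_trans; apply.
  rewrite (_ : x1 + x2 = (x2 + x0) + (x1 - x0)) ?ler_normD//.
  by rewrite addrACA subrr addr0 addrC.
pose A := [set r.2 - `|r.1 - x0| | r in G].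
have A0 : A !=set0 by exists (0 - `|0 - x0|), (0, 0).
have Aub x2 r2 : G (x2, r2) -> ubound A (`|x2 + x0| - r2).
  by move=> G2 _ [[x1 r1] /= G1 <-]; exact: sep.
have supA : has_sup A by split => //; exists (`|0 + x0| - 0); exact: Aub.
pose c := sup A.
have c1 x r : G (x, r) -> r - c <= `|x - x0|.
  move=> Gx; rewrite lerBlDr -lerBlDl; apply: ub_le_sup; first exact: supA.2.
  by exists (x, r).
have c2 x r : G (x, r) -> r + c <= `|x + x0|.
  by move=> Gx; rewrite addrC -lerBrDr; apply: ge_sup => //; exact: Aub.
have GZ a x r : G (x, r) -> G (a *: x, a * r).
  by move=> Gx; have := Glin a _ _ _ _ Gx G0; rewrite !addr0.
exists [set p | exists x r l, [/\ G (x, r), p.1 = x + l *: x0 & p.2 = r + l * c]].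
split.
- by move=> [x r] Gx; exists x, r, 0; rewrite scale0r mul0r !addr0.
- split.
    move=> a x r y s [x' [r' [l [Gx' /= -> ->]]]] [y' [s' [m [Gy' /= -> ->]]]].
    exists (a *: x' + y'), (a * r' + s'), (a * l + m); split=> /=.
    + exact: Glin.
    + by rewrite scalerDl scalerDr scalerA addrACA.
    + by rewrite mulrDl mulrDr mulrA addrACA.
  move=> x r [x' [r' [l [Gx' /= -> ->]]]].
  have [l0|l0|->] := ltgtP l 0; last by rewrite mul0r scale0r !addr0 Gle.
  + have nl0 : 0 < - l by rewrite oppr_gt0.
    have := c1 _ _ (GZ (- l)^-1 _ _ Gx').
    rewrite -(ler_pM2l nl0) mulrBr mulVKf ?gt_eqF// mulNr opprK => /le_trans; apply.
    rewrite -{1}(gtr0_norm nl0) -normrZ scalerBr scalerA divff ?gt_eqF//.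
    by rewrite scale1r scaleNr opprK.
  + have := c2 _ _ (GZ l^-1 _ _ Gx').
    rewrite -(ler_pM2l l0) mulrDr mulVKf ?gt_eqF// => /le_trans; apply.
    rewrite -{1}(gtr0_norm l0) -normrZ scalerDr scalerA divff ?gt_eqF//.
    by rewrite scale1r.
- by exists c, 0, 0, 1; rewrite scale1r mul1r !add0r.
Qed.

(** The Hahn-Banach theorem for the form a *: d |-> a * `|d|; a maximal
    dominated graph is total because it can be extended by any vector. *)
Lemma hahn_banach_norming (d : E) :
  exists2 y : {lc E -> R^o}, (forall x, `|y x| <= `|x|) & y d = `|d|.
Proof.
pose base := [set p : E * R | exists a : R, p = (a *: d, a * `|d|)].
have base_dom : dominated_graph base.
  split=> [a x r y s [b [-> ->]] [c [-> ->]]|x r [a [-> ->]]].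
    by exists (a * b + c); rewrite scalerDl mulrDl scalerA mulrA.
  by rewrite normrZ ler_wpM2r// ler_norm.
(* The sets G are ordered by inclusion without being required to contain base,
   so that the union of the empty chain is admissible. *)
have [|G [Gdom Gmax]] := @Zorn_bigcup (E * R)%type
    [set G | dominated_graph (base `|` G)].
  move=> C CP Ctot; split=> [a x r y s|x r].
  - move=> [bx|[X CX Xx]] [by_|[Y CY Yy]].
    + by left; exact: base_dom.1.
    + have [+ _] := CP _ CY; move=> /(_ a x r y s (or_introl bx) (or_intror Yy)).
      by move=> [?|?]; [left|right; exists Y].
    + have [+ _] := CP _ CX; move=> /(_ a x r y s (or_intror Xx) (or_introl by_)).
      by move=> [?|?]; [left|right; exists X].
    + have [XY|YX] := Ctot _ _ CX CY.
        have [+ _] := CP _ CY.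
        move=> /(_ a x r y s (or_intror (XY _ Xx)) (or_intror Yy)).
        by move=> [?|?]; [left|right; exists Y].
      have [+ _] := CP _ CX.
      move=> /(_ a x r y s (or_intror Xx) (or_intror (YX _ Yy))).
      by move=> [?|?]; [left|right; exists X].
  - move=> [bx|[X CX Xx]]; first exact: base_dom.2.
    by have [_] := CP _ CX; apply; right.
have b00 : (base `|` G) (0, 0) by left; exists 0; rewrite scale0r mul0r.
have total x : exists r, (base `|` G) (x, r).
  have [G' [GG' G'dom [c G'c]]] := dominated_graph_extend x b00 Gdom.
  have [G'G|nG'G] := pselect (G' `<=` G); first by exists c; right; exact: G'G.
  exfalso; apply: (Gmax G').
    by split=> // [p Gp]; apply: GG'; right.
  rewrite /= (_ : base `|` G' = G')//; apply/seteqP; split=> [p [bp|//]|p]; last by right.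
  by apply: GG'; left.
have [f Gf] := choice total.
have Guniq x r s : (base `|` G) (x, r) -> (base `|` G) (x, s) -> r = s.
  move=> Gr Gs.
  have h r' s' : (base `|` G) (x, r') -> (base `|` G) (x, s') -> s' <= r'.
    move=> Gr' Gs'; have := Gdom.2 _ _ (Gdom.1 (-1) _ _ _ _ Gr' Gs').
    by rewrite scaleN1r addNr normr0 mulN1r addrC subr_le0.
  by apply/eqP; rewrite eq_le !h.
have fle x : `|f x| <= 1 * `|x|.
  rewrite mul1r ler_norml (Gdom.2 _ _ (Gf x)) andbT.
  have := Gdom.2 _ _ (Gdom.1 (-1) _ _ _ _ (Gf x) b00).
  by rewrite !addr0 scaleN1r normrN mulN1r lerNl.
have flin : linear (f : E -> R^o).
  move=> a x y; apply: (Guniq (a *: x + y)); first exact: Gf.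
  exact: Gdom.1.
have [y yE] := lc_of_linear_bound flin fle.
exists y => [x|]; first by rewrite yE -[leRHS]mul1r.
rewrite yE; apply: (Guniq d); first exact: Gf.
by left; exists 1; rewrite scale1r mul1r.
Qed.

End hahn_banach.
End functional_analysis.

(** * The Riesz representation theorem *)

Section hilbert.
Context {R : realType}.
Add Ring Rr : (sring_theory R).

Lemma cauchy_seq_cvg (V : completeNormedModType R) (u : nat -> V) :
  (forall e : R, 0 < e ->
    exists N, forall n m, (N <= n)%N -> (N <= m)%N -> `|u n - u m| < e) ->
  cvg (u @ \oo).
Proof.
move=> uC; apply/cauchy_cvgP/cauchyP => e e0.
have [N uN] := uC e e0; exists (u N), N => // n Nn /=.
by rewrite -ball_normE /=; exact: uN.
Qed.

Variables (H : completeNormedModType R) (ip : {dot H for idfun}).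
Hypothesis hH : hilbert_norm ip.

Lemma ipC h k : ip h k = ip k h.
Proof. by rewrite hermC expr0 mul1r. Qed.

Lemma ipDr h k l : ip h (k + l) = ip h k + ip h l.
Proof. exact: linearDr. Qed.

Lemma ipDl h k l : ip (h + k) l = ip h l + ip k l.
Proof. exact: linearDl. Qed.

Lemma ipZr a h k : ip h (a *: k) = a * ip h k.
Proof. exact: linearZr_LR. Qed.

Lemma ipZl a h k : ip (a *: h) k = a * ip h k.
Proof. exact: linearZl_LR. Qed.

Lemma ipNr h k : ip h (- k) = - ip h k.
Proof. by rewrite -scaleN1r ipZr mulN1r. Qed.

Lemma ipNl h k : ip (- h) k = - ip h k.
Proof. by rewrite -scaleN1r ipZl mulN1r. Qed.

Lemma normr_sqrD h k : `|h + k| ^+ 2 = `|h| ^+ 2 + 2 * ip h k + `|k| ^+ 2.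
Proof. by rewrite -!hH ipDr !ipDl (ipC k h) mulr2n mulrDl mul1r !addrA. Qed.

Lemma cauchy_schwarz h k : `|ip h k| <= `|h| * `|k|.
Proof.
have le_ip h' k' : ip h' k' <= `|h'| * `|k'|.
  have : `|h' + k'| ^+ 2 <= (`|h'| + `|k'|) ^+ 2.
    by rewrite lerXn2r ?nnegrE ?addr_ge0// ler_normD.
  have two0 : 0 < 2 :> R by [].
  move=> le2; rewrite -subr_ge0 -(pmulr_rge0 _ two0); move: le2.
  rewrite -subr_ge0; congr (0 <= _).
  by rewrite normr_sqrD; sring R.
rewrite ler_norml le_ip andbT lerNl -ipNr.
by rewrite (le_trans (le_ip _ _))// normrN.
Qed.

Lemma parallelogram (h k : H) :
  `|h + k| ^+ 2 + `|h - k| ^+ 2 = 2 * (`|h| ^+ 2 + `|k| ^+ 2).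
Proof. by rewrite !normr_sqrD ipNr normrN; sring R. Qed.

(** The representing vector minimises `|h| ^+ 2 - 2 * xi h; by the
    parallelogram law minimising sequences are Cauchy. *)
Lemma riesz (xi : {lc H -> R^o}) : exists h, forall k, ip h k = xi k.
Proof.
pose J (h : H) : R := `|h| ^+ 2 - 2 * (xi h : R).
have [M M0 xiM] := lc_bound xi.
have Jge h : - M ^+ 2 <= J h.
  have xih : 0 <= M * `|h| - xi h.
    by rewrite subr_ge0 (le_trans (ler_norm _)).
  have := addr_ge0 (sqr_ge0 (`|h| - M)) (addr_ge0 xih xih).
  by rewrite -(subr_ge0 (- _)); congr (0 <= _); rewrite /J; sring R.
have infJ : has_inf (range J).
  by split; [exists (J 0), 0|exists (- M ^+ 2) => _ [h _ <-]].
pose m := inf (range J).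
have mJ h : m <= J h by apply: ge_inf; [exact: infJ.2|exists h].
have /choice[u uP] (n : nat) : exists h, J h < m + n.+1%:R^-1.
  have n0 : 0 < n.+1%:R^-1 :> R by [].
  have [_ [h _ <-] hm] := inf_adherent n0 infJ.
  by exists h.
have JD h k : J (h + k) = J h + 2 * (ip h k - xi k) + `|k| ^+ 2.
  by rewrite /J normr_sqrD linearD/=; sring R.
have Jmid h k : `|h - k| ^+ 2 <= 2 * ((J h - m) + (J k - m)).
  have := mJ (2^-1 *: (h + k)).
  have xiE : xi (2^-1 *: (h + k)) = 2^-1 * (xi h + xi k).
    by rewrite -[RHS]/(2^-1 *: (xi h + xi k : R^o)) -linearD -linearZ.
  rewrite /J xiE normrZ exprMn ger0_norm ?invr_ge0//.
  rewrite mulVKf ?pnatr_eq0// => mle.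
  have : 0 <= 4 * (2^-1 ^+ 2 * `|h + k| ^+ 2 - (xi h + xi k) - m).
    by rewrite mulr_ge0// subr_ge0.
  rewrite (_ : 4 = 2 ^+ 2 :> R) -?natrX// natrX !mulrBr mulrA -exprMn mulfV ?pnatr_eq0// expr1n mul1r.
  move=> ge0; rewrite -subr_ge0; move: ge0; congr (0 <= _).
  have -> : `|h - k| ^+ 2 = 2 * (`|h| ^+ 2 + `|k| ^+ 2) - `|h + k| ^+ 2.
    by rewrite -parallelogram; sring R.
  by sring R.
have uC : cvg (u @ \oo).
  apply: cauchy_seq_cvg => e e0.
  have e20 : 0 < e ^+ 2 / 4 by rewrite divr_gt0// exprn_gt0.
  have [N _ Nle] := @near_infty_natSinv_lt R (PosNum e20).
  exists N => k l Nk Nl; rewrite -(@ltr_pXn2r _ 2) ?nnegrE ?normr_ge0 ?(ltW e0)//.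
  apply: le_lt_trans (Jmid _ _) _.
  have h n : (N <= n)%N -> J (u n) - m < e ^+ 2 / 4.
    by move=> Nn; rewrite ltrBlDl (lt_trans (uP n))// ltrD2l; exact: Nle.
  rewrite (lt_le_trans (_ : _ < 2 * (e ^+ 2 / 4 + e ^+ 2 / 4)))//.
    by rewrite ltr_pM2l// ltrD// h.
  rewrite le_eqVlt; apply/orP; left; apply/eqP.
  by rewrite -[RHS](@divfK _ 4)// ?pnatr_eq0//; sring R.
pose h := lim (u @ \oo); exists h.
suff ge0 k : 0 <= ip h k - xi k.
  move=> k; apply/eqP; rewrite -subr_eq0 eq_le ge0 andbT.
  by have := ge0 (- k); rewrite ipNr linearN/= -opprD oppr_ge0.
rewrite leNgt; apply/negP => b0.
set b := ip h k - xi k in b0; pose a := `|k| ^+ 2.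
have a0 : 0 <= a by exact: sqr_ge0.
have a1 : 0 < a + 1 by rewrite ltr_wpDl.
(* If ip h k < xi k, the step t *: k makes J smaller than its infimum m, as the
   variation 2 * t * b + t ^+ 2 * a is negative; a + 1 avoids dividing by 0. *)
pose t := - b / (a + 1).
have t0 : 0 < t by rewrite divr_gt0// oppr_gt0.
have iph : (fun n => 2 * t * (ip (u n) k - xi k) + t ^+ 2 * a + n.+1%:R^-1)
    @ \oo --> 2 * t * b + t ^+ 2 * a + 0.
  apply: cvgD; last exact: cvg_harmonic.
  apply: cvgD; last exact: cvg_cst.
  apply: cvgM; first exact: cvg_cst.
  apply: cvgB; last exact: cvg_cst.
  apply/cvgrPdist_le => e e0.
  have k0 : 0 < `|k| + 1 by rewrite ltr_wpDl.
  have /cvgrPdist_le /(_ (e / (`|k| + 1))) := uC.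
  move=> /(_ (divr_gt0 e0 k0)); apply: filterS => n hn.
  rewrite -ipNl -ipDl (le_trans (cauchy_schwarz _ _))//.
  rewrite (le_trans (ler_wpM2r _ hn))// -mulrA ler_piMr ?(ltW e0)//.
  by rewrite ler_pdivrMl// mulr1 lerDl.
have : 0 <= 2 * t * b + t ^+ 2 * a + 0.
  rewrite -(cvg_lim _ iph)//; apply: limr_ge; first by apply/cvg_ex; eexists; exact: iph.
  apply: nearW => n.
  have := mJ (u n + t *: k); rewrite JD ipZr linearZ/= => mle.
  have := uP n; rewrite -subr_gt0 => ult.
  have : 0 <= J (u n) + 2 * (t * ip (u n) k - t *: (xi k : R^o)) + `|t *: k| ^+ 2 - m
    by rewrite subr_ge0.
  rewrite -[t *: (_ : R^o)]/(t * _) normrZ exprMn ger0_norm ?(ltW t0)// => /addr_ge0.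
  move=> /(_ _ (ltW ult)); congr (0 <= _); rewrite /a.
  set c := xi k; set d := ip _ k; set v := _^-1; set w := `|k|.
  by sring R.
have -> : 2 * t * b + t ^+ 2 * a + 0 = t * (2 * b + t * a) by sring R.
rewrite pmulr_rge0//.
have -> : 2 * b + t * a = b * (a + 2) / (a + 1).
  rewrite -(mulfK (lt0r_neq0 a1) (2 * b + t * a)); congr (_ / _).
  have -> : (2 * b + t * a) * (a + 1) = 2 * b * (a + 1) + a * (t * (a + 1)).
    by sring R.
  by rewrite /t divfK ?lt0r_neq0//; sring R.
apply/negP; rewrite -ltNge pmulr_llt0 ?invr_gt0// nmulr_rlt0//.
by rewrite ltr_wpDl.
Qed.
End hilbert.

(** * Continuity and local boundedness of C_0-semigroups *)

Section semigroup.
Context {R : realType}.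
Variables (E : completeNormedModType R) (S : R -> {lc E -> E}).
Hypothesis hS : C0_semigroup S.

Lemma semigroup0 x : S 0 x = x. Proof. by case: hS. Qed.

Lemma semigroupD s t x : 0 <= s -> 0 <= t -> S (s + t) x = S s (S t x).
Proof. by case: hS => _ + _; exact. Qed.

Lemma semigroup_right_cvg0 x (e : R) : 0 < e ->
  exists2 d, 0 < d & forall t, 0 <= t -> t < d -> `|S t x - x| < e.
Proof.
move=> e0; case: hS => _ _ /(_ x)/cvgrPdist_lt/(_ e e0)[d /= d0 dP].
exists d => // t; rewrite le_eqVlt => /predU1P[<- _|t0 td].
  by rewrite semigroup0 subrr normr0.
by rewrite distrC; apply: dP => //=; rewrite sub0r normrN gtr0_norm.
Qed.

(** Otherwise operators S (t n) with t n -> 0 would have unbounded norms,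
    although they converge pointwise to the identity. *)
Lemma semigroup_bounded_near0 : exists d M : R, [/\ 0 < d, 0 < M &
  forall t x, 0 <= t -> t <= d -> `|S t x| <= M * `|x|].
Proof.
apply: contrapT => nb.
have /choice[p pP] (n : nat) : exists p : R * E, [/\ 0 <= p.1, p.1 <= n.+1%:R^-1 &
    n.+1%:R * `|p.2| < `|S p.1 p.2|].
  apply: contrapT => h; apply: nb; exists n.+1%:R^-1, n.+1%:R; split=> //.
  by move=> t x t0 tn; rewrite leNgt; apply/negP => hx; apply: h; exists (t, x).
pose F := range (fun n => S (p n).1 : E -> E).
have Fbl f : F f -> bounded_fun_norm f /\ linear f.
  move=> [n _ <-]; split; last by move=> a x y; exact: linearP.
  apply/bounded_funP/linear_bounded_continuous; exact: lc_continuous.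
have Fpt : pointwise_bounded F.
  move=> x; have [d d0 dP] := semigroup_right_cvg0 x ltr01.
  have [N _ NP] := @near_infty_natSinv_lt R (PosNum d0).
  exists (`|x| + 1 + \sum_(k < N) `|S (p k).1 x|) => _ [n _ <-].
  have [nN|Nn] := ltnP n N.
    by rewrite (bigD1 (Ordinal nN))//= addrCA lerDl addr_ge0// sumr_ge0.
  have [p0 pn _] := pP n.
  rewrite (@le_trans _ _ (`|x| + 1))//; last by rewrite lerDl sumr_ge0.
  rewrite -lerBlDl (le_trans (lerB_dist _ _))// ltW// dP// (le_lt_trans pn)//.
  exact: NP.
have [M MP] := Banach_Steinhauss Fbl Fpt 1.
have [p0 pn px] := pP (Num.truncn M).
set n := Num.truncn M in p0 pn px; set x := (p n).2 in px.
have x0 : `|x| != 0.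
  apply/eqP => x0; move: px; rewrite x0 mulr0 (normr0_eq0 x0) linear0 normr0.
  by rewrite ltxx.
have := MP _ (ex_intro2 _ _ n I erefl) (`|x|^-1 *: x).
rewrite linearZ/= !normrZ normfV normr_id mulVf// => /(_ (lexx _)).
apply/negP; rewrite -ltNge (lt_trans (truncnS_gt M))// -/n.
rewrite -(@ltr_pM2l _ `|x|); last by rewrite normr_gt0 -normr_eq0.
by rewrite mulVKf// mulrC.
Qed.

(** The bound near 0 propagates to [0, T] by S t = S d (S (t - d)). *)
Lemma semigroup_bounded (T : R) : exists2 M : R, 0 < M &
  forall t x, 0 <= t -> t <= T -> `|S t x| <= M * `|x|.
Proof.
have [d [M [d0 M0 dM]]] := semigroup_bounded_near0.
suff bk (k : nat) : exists2 Mk : R, 0 < Mk &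
    forall t x, 0 <= t -> t <= d * k.+1%:R -> `|S t x| <= Mk * `|x|.
  have [Mk Mk0 MkP] := bk (Num.truncn (T / d)); exists Mk => // t x t0 tT.
  apply: MkP => //; apply: le_trans tT _.
  by rewrite mulrC -ler_pdivrMr// ltW// truncnS_gt.
elim: k => [|k [Mk Mk0 MkP]].
  by exists M => // t x t0; rewrite mulr1; exact: dM.
exists (M + M * Mk); first by rewrite addr_gt0// mulr_gt0.
move=> t x t0 tk; rewrite mulrDl.
have [td|/ltW dt] := leP t d.
  by rewrite (le_trans (dM _ _ t0 td))// lerDl !mulr_ge0// ltW.
rewrite -[in leLHS](subrKC d t) semigroupD ?subr_ge0 ?(ltW d0)//.
rewrite (le_trans (dM _ _ (ltW d0) (lexx _)))//.
rewrite (@le_trans _ _ (M * Mk * `|x|))//; last by rewrite lerDr mulr_ge0// ltW.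
rewrite -mulrA ler_pM2l// MkP ?subr_ge0// lerBlDr (le_trans tk)//.
by rewrite -natr1 mulrDr mulr1.
Qed.

(** Joint continuity. As S t x - S t x0 is controlled by the bound on S t, only
    the orbit of x0 matters; for s <= s + h the difference of its values is
    S s (S h x0 - x0), so that right continuity at time 0 is enough. *)
Lemma semigroup_continuous (t0 : R) (x0 : E) (e : R) : 0 <= t0 -> 0 < e ->
  exists2 d : R, 0 < d & forall t x, 0 <= t -> `|t - t0| < d -> `|x - x0| < d ->
    `|S t x - S t0 x0| < e.
Proof.
move=> t00 e0; have [M M0 MP] := semigroup_bounded (t0 + 1).
have eM : 0 < e / 2 / M by rewrite !divr_gt0.
have [d d0 dP] := semigroup_right_cvg0 x0 eM.
exists (Num.min 1 (Num.min d (e / 2 / M))); first by rewrite !lt_min ltr01 d0.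
move=> t x tge0; rewrite !lt_min => /and3P[t1 td _] /and3P[_ _ xd].
rewrite -(subrKA (S t x0)) -linearB (splitr e).
rewrite (le_lt_trans (ler_normD _ _))//; apply: ltrD.
  have tT : t <= t0 + 1.
    by rewrite -lerBlDl (le_trans (ler_norm _))// ltW.
  by rewrite (le_lt_trans (MP _ _ tge0 tT))// mulrC -ltr_pdivlMr.
have key s h : 0 <= s -> s <= t0 + 1 -> 0 <= h -> h < d ->
    `|S (s + h) x0 - S s x0| < e / 2.
  move=> s0 sT h0 hd; rewrite semigroupD// -linearB.
  by rewrite (le_lt_trans (MP _ _ s0 sT))// mulrC -ltr_pdivlMr// dP.
have [tt|/ltW tt] := leP t0 t.
  rewrite -[in S t](subrKC t0 t); apply: key => //; rewrite ?subr_ge0//.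
    by rewrite lerDl.
  by rewrite (le_lt_trans (ler_norm _)).
rewrite distrC -[in S t0](subrKC t t0); apply: key => //; rewrite ?subr_ge0//.
  by rewrite (le_trans tt)// lerDl.
by rewrite (le_lt_trans (ler_norm _))// distrC.
Qed.

End semigroup.

(** * Bochner integrals of bounded functions *)

Section finite_valued.
Context d (T : measurableType d) (R : realType).
Variables (mu : {measure set T -> \bar R}) (D : set T).
Hypotheses (mD : measurable D) (muD : (mu D < +oo)%E).

(** Simple functions with values in an arbitrary type: grid indices and truth
    values are combined with vectors below. *)
Definition finite_valued (X : Type) (s : T -> X) :=
  finite_set (s @` D) /\ forall v, measurable (D `&` s @^-1` [set v]).

Lemma finite_valued_preimage (X : Type) (s : T -> X) (A : set X) :
  finite_valued s -> measurable (D `&` s @^-1` A).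
Proof.
move=> [fs ms].
rewrite (_ : _ `&` _ = \bigcup_(v in s @` D `&` A) (D `&` s @^-1` [set v])).
  by apply: fin_bigcup_measurable => //; exact: finite_setIl.
apply/seteqP; split=> [x [Dx Asx]|x [v [_ Av] [Dx /= sv]]].
  by exists (s x) => //; split => //; exists x.
by split=> //=; rewrite sv.
Qed.

Lemma finite_valued_comp2 (X Y Z : Type) (phi : X -> Y -> Z) s s' :
  finite_valued s -> finite_valued s' ->
  finite_valued (fun x => phi (s x) (s' x)).
Proof.
move=> fs fs'; split.
  apply: (@sub_finite_set _ _ [set phi a b | a in s @` D & b in s' @` D]).
    by move=> _ [x Dx <-]; exists (s x); [exists x|exists (s' x); [exists x|]].
  by apply: finite_image2; [exact: fs.1|exact: fs'.1].
move=> w; rewrite (_ : _ `&` _ = \bigcup_(v in s @` D)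
    ((D `&` s @^-1` [set v]) `&` (D `&` s' @^-1` [set v' | phi v v' = w]))).
  apply: fin_bigcup_measurable; first exact: fs.1.
  by move=> v _; apply: measurableI; exact: finite_valued_preimage.
apply/seteqP; split=> [x [Dx /= <-]|x [v _ [[Dx /= sv] [_ /= vw]]]]; last by split=> //=; rewrite sv.
by exists (s x); [exists x|].
Qed.

Lemma finite_valued_cst (X : Type) (v : X) : finite_valued (fun=> v).
Proof.
split; first by apply: (@sub_finite_set _ _ [set v]) => // _ [x _ <-].
move=> w; have [->|vw] := pselect (v = w).
  by rewrite (_ : _ `&` _ = D)//; apply/seteqP; split=> // x [].
by rewrite (_ : _ `&` _ = set0)//; apply/seteqP; split=> // x [].
Qed.

Lemma finite_valued_comp (X Z : Type) (phi : X -> Z) s :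
  finite_valued s -> finite_valued (phi \o s).
Proof.
by move=> fs; exact: (finite_valued_comp2 (fun a _ => phi a) fs (finite_valued_cst tt)).
Qed.

Lemma finite_valued_measurable (s : T -> R) :
  finite_valued s -> measurable_fun D s.
Proof. by move=> fs _ A _; exact: finite_valued_preimage. Qed.

Lemma finite_valued_integrable (s : T -> R) :
  finite_valued s -> mu.-integrable D (EFin \o s).
Proof.
move=> fs; apply: measurable_bounded_integrable => //.
  exact: finite_valued_measurable.
exists (\sum_(r <- fset_set (s @` D)) `|r|); split=> [|M MA x Dx].
  exact: num_real.
have sA : s x \in fset_set (s @` D).
  by rewrite in_fset_set ?inE; [exists x|exact: fs.1].
apply: le_trans (ltW MA); rewrite (big_rem _ sA)/= lerDl.
by apply: sumr_ge0 => r _.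
Qed.

Lemma finite_valued_integral (X : choiceType) (s : T -> X) (phi : X -> R) :
  finite_valued s -> (\int[mu]_(x in D) (phi (s x))%:E)%E =
  (\sum_(v <- fset_set (s @` D)) phi v * fine (mu (D `&` s @^-1` [set v])))%:E.
Proof.
move=> fs; pose F v := D `&` s @^-1` [set v].
have DE : \big[setU/set0]_(v <- fset_set (s @` D)) F v = D.
  rewrite bigsetU_fset_set; last exact: fs.1.
  by apply/seteqP; split=> [x [v _ []]//|x Dx]; exists (s x) => //; exists x.
rewrite -[in LHS]DE (@integral_bigsetU_EFin _ _ _ _ _ F (phi \o s))//.
- rewrite -sumEFin; apply: eq_bigr => v _.
  rewrite (eq_integral (cst (phi v)%:E)); last first.
    by move=> x; rewrite inE => -[_ /= <-].
  rewrite integral_cst; last exact: fs.2.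
  rewrite EFinM fineK// ge0_fin_numE//; apply: le_lt_trans muD.
  by apply: le_measure; rewrite ?inE//; exact: fs.2.
- exact: fs.2.
- by apply/trivIsetP => v w _ _ vw; apply/seteqP; split=> // x [[_ /= sv] [_ /= sw]];
  move: vw; rewrite -sv sw eqxx.
- rewrite DE; apply/measurable_EFinP; apply: finite_valued_measurable.
  exact: finite_valued_comp.
Qed.

End finite_valued.

Section bochner.
Context d (T : measurableType d) (R : realType).
Variables (mu : {measure set T -> \bar R}) (D : set T).
Hypotheses (mD : measurable D) (muD : (mu D < +oo)%E).
Variable E : completeNormedModType R.
Implicit Types (s : T -> E) (y : {lc E -> R^o}).

Lemma simple_onP s : simple_on mu D s <-> finite_valued D s.
Proof.
split=> [[fs ms _]//|[fs ms]]; split=> // v _; apply: le_lt_trans muD.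
by apply: le_measure; rewrite ?inE.
Qed.

Lemma simple_integral_form s y : finite_valued D s ->
  (\int[mu]_(x in D) (y (s x))%:E)%E = (y (simple_integral mu D s))%:E.
Proof.
move=> fs; rewrite (finite_valued_integral mD muD (y : E -> R) fs); congr EFin.
rewrite /simple_integral fsbig_finite; last exact: fs.1.
by rewrite raddf_sum; apply: eq_bigr => v _; rewrite /= lc_formZ mulrC.
Qed.

(** A norming functional of the left-hand side reduces the claim to real-valued
    functions. *)
Lemma simple_integral_dist s s' : finite_valued D s -> finite_valued D s' ->
  (`|simple_integral mu D s - simple_integral mu D s'|%:E <=
   \int[mu]_(x in D) `|s x - s' x|%:E)%E.
Proof.
move=> fs fs'.
have [y yle yE] := hahn_banach_norming (simple_integral mu D s - simple_integral mu D s').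
rewrite -yE linearB EFinB -!simple_integral_form//.
have fy := finite_valued_integrable mD muD (finite_valued_comp mD (y : E -> R) fs).
have fy' := finite_valued_integrable mD muD (finite_valued_comp mD (y : E -> R) fs').
rewrite -integralB//; apply: le_integral => //.
- exact: integrableB.
- apply: (@finite_valued_integrable _ _ _ mu D mD muD (fun x => `|s x - s' x|)).
  exact: (finite_valued_comp2 (fun a b : E => `|a - b|) fs fs').
- move=> x _ /=; rewrite -EFinB lee_fin -linearB/=.
  by rewrite (le_trans (ler_norm _)).
Qed.

Section existence.
Variables (f : T -> E) (s_ : nat -> T -> E).
Hypotheses (fs : forall n, finite_valued D (s_ n))
  (sf : forall x, D x -> s_ n x @[n --> \oo] --> f x).

Lemma measurable_dist s : finite_valued D s ->
  measurable_fun D (fun x => `|f x - s x|).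
Proof.
move=> fss; apply: (@measurable_fun_cvg _ _ _ D (fun n x => `|s_ n x - s x|)).
  move=> n; apply: finite_valued_measurable.
  exact: (finite_valued_comp2 (fun a b : E => `|a - b|) (fs n) fss).
by move=> x Dx; apply: cvg_norm; apply: cvgB; [exact: sf|exact: cvg_cst].
Qed.

Lemma measurable_form y : measurable_fun D (fun x => y (f x) : R).
Proof.
apply: (@measurable_fun_cvg _ _ _ D (fun n x => y (s_ n x))).
  by move=> n; apply: finite_valued_measurable; exact: (finite_valued_comp mD (y : E -> R) (fs n)).
by move=> x Dx; apply: (cvg_comp _ _ (sf Dx)); exact: lc_continuous.
Qed.

Variable M : R.
Hypothesis sM : forall n x, D x -> `|s_ n x| <= M.

Let fM x : D x -> `|f x| <= M.
Proof.
move=> Dx; have sfx : `|s_ n x| @[n --> \oo] --> `|f x| by apply: cvg_norm; exact: sf.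
rewrite -(cvg_lim _ sfx)//; apply: limr_le; first by apply/cvg_ex; eexists; exact: sfx.
by apply: nearW => n; exact: sM.
Qed.

Let distM n x : D x -> `|f x - s_ n x| <= M + M.
Proof. by move=> Dx; rewrite (le_trans (ler_normB _ _))// lerD ?fM ?sM. Qed.

(** Dominated convergence: f and the s_ n are bounded, and mu D is finite. *)
Lemma integral_dist_cvg0 :
  (\int[mu]_(x in D) `|f x - s_ n x|%:E)%E @[n --> \oo] --> 0%E.
Proof.
rewrite [X in _ --> X](_ : 0%E = (\int[mu]_(x in D) (EFin \o cst (0%R : R)) x)%E); last first.
  by rewrite integral0_eq.
apply: (@dominated_cvg _ _ _ mu D mD _ _ (EFin \o cst (M + M))).
- by move=> n; apply/measurable_EFinP; exact: measurable_dist.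
- move=> x Dx; apply: cvg_EFin; first exact: nearW.
  rewrite -[X in _ --> X](@normr0 _ E) -(subrr (f x)); apply: cvg_norm.
  by apply: cvgB; [exact: cvg_cst|exact: sf].
- by [].
- apply: (@measurable_bounded_integrable _ _ _ mu (cst (M + M)) D mD muD) => //.
  exact: bounded_cst.
- by move=> n x Dx; rewrite lee_fin /= normr_id distM.
Qed.

Lemma bochner_integral_exists : exists v, is_bochner_integral mu D f v.
Proof.
have /fine_cvgP[_ Ic] := integral_dist_cvg0.
have dfin n : (\int[mu]_(x in D) `|f x - s_ n x|%:E)%E \is a fin_num.
  apply: integrable_fin_num => //.
  apply: (@measurable_bounded_integrable _ _ _ mu (fun x => `|f x - s_ n x|) D mD muD).
    exact: measurable_dist.
  exists (M + M); split=> [|N MN x Dx]; first exact: num_real.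
  by rewrite /= normr_id (le_trans (distM _ Dx))// ltW.
have : cvg ((fun n => simple_integral mu D (s_ n)) @ \oo).
  apply: cauchy_seq_cvg => e e0.
  have /cvgrPdist_lt/(_ (e / 2))[|N _ NP] := Ic; first by rewrite divr_gt0.
  exists N => n m Nn Nm.
  have NP' k : (N <= k)%N -> (\int[mu]_(x in D) `|f x - s_ k x|%:E < (e / 2)%:E)%E.
    move=> Nk; rewrite -[X in (X < _)%E](fineK (dfin k)) lte_fin.
    by have := NP k Nk; rewrite /= sub0r normrN; apply: le_lt_trans; exact: ler_norm.
  rewrite -lte_fin; apply: le_lt_trans (simple_integral_dist (fs n) (fs m)) _.
  rewrite (splitr e) EFinD.
  apply: le_lt_trans (lteD (NP' _ Nn) (NP' _ Nm)).
  have mdist k : measurable_fun D (fun x => `|f x - s_ k x|%:E).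
    by apply/measurable_EFinP; exact: measurable_dist.
  rewrite -ge0_integralD//.
  apply: ge0_le_integral => //.
  - apply/measurable_EFinP; apply: finite_valued_measurable.
    exact: (finite_valued_comp2 (fun a b : E => `|a - b|) (fs n) (fs m)).
  - exact: emeasurable_funD.
  - move=> x Dx; rewrite -EFinD lee_fin (distrC (f x) (s_ n x)).
    by rewrite -(subrKA (f x)) ler_normD.
move=> Icvg; exists (lim ((fun n => simple_integral mu D (s_ n)) @ \oo)), s_.
split=> //; first by move=> n; exact/simple_onP.
- by apply: aeW => x Dx; exact: sf.
- exact: integral_dist_cvg0.
Qed.

(** Any sequence of simple functions witnessing the integral has integrals that
    tend to it, while their images under y tend in mean to y (f x). *)
Lemma bochner_integral_form y :
  (\int[mu]_(x in D) (y (f x))%:E)%E = (y (bochner_integral mu D f))%:E.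
Proof.
have : is_bochner_integral mu D f (bochner_integral mu D f).
  by have [v vP] := bochner_integral_exists; exact: (xgetPex 0 (ex_intro _ v vP)).
move=> [s [fss _ s0 sv]].
have {}fss n : finite_valued D (s n) by exact/simple_onP.
have [C C0 yC] := lc_bound y.
have iyf : mu.-integrable D (EFin \o (fun x => y (f x) : R)).
  apply: measurable_bounded_integrable => //; first exact: measurable_form.
  exists (C * M); split=> [|N CN x Dx]; first exact: num_real.
  by rewrite /= (le_trans (yC _))// (le_trans _ (ltW CN))// ler_pM2l// fM.
have iys n : mu.-integrable D (EFin \o (fun x => y (s n x) : R)).
  exact: (finite_valued_integrable mD muD (finite_valued_comp mD (y : E -> R) (fss n))).
have h1 : (y (simple_integral mu D (s n)))%:E @[n --> \oo] -->
    (y (bochner_integral mu D f))%:E.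
  apply: cvg_EFin; first exact: nearW.
  by apply: (cvg_comp _ _ sv); exact: lc_continuous.
have h2 : (y (simple_integral mu D (s n)))%:E @[n --> \oo] -->
    (\int[mu]_(x in D) (y (f x))%:E)%E.
  apply/sube_cvg0; first exact: integrable_fin_num.
  apply/cvg_abse0P.
  apply: (@squeeze_cvge _ _ _ _ (cst 0%E) _
    (fun n => (C%:E * \int[mu]_(x in D) `|f x - s n x|%:E)%E)).
  - apply: nearW => n; rewrite abse_ge0/= -simple_integral_form// -integralB//; last exact: iys.
    have md : measurable_fun D (fun x => `|f x - s n x|%:E).
      by apply/measurable_EFinP; exact: measurable_dist.
    rewrite -ge0_integralZl ?lee_fin ?(ltW C0)//.
    have mB : measurable_fun D (fun x => ((y (s n x))%:E - (y (f x))%:E)%E).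
      apply: emeasurable_funB; first exact: (measurable_int mu (iys n)).
      exact: (measurable_int mu iyf).
    apply: le_trans (le_abse_integral mu mD mB) _.
    apply: ge0_le_integral => //.
    + exact: measurableT_comp.
    + exact: measurable_funeM.
    + move=> x Dx; rewrite -EFinB -EFinM lee_fin -linearB/=.
      by rewrite (le_trans (yC _))// distrC.
  - exact: cvg_cst.
  - by rewrite -[X in _ --> X](mule0 C%:E); apply: cvgeZl.
exact: (cvg_unique _ h2 h1).
Qed.

End existence.
End bochner.

(** * Affine substitution in Lebesgue integrals *)

Section lebesgue_affine.
Context {R : realType}.
Local Notation leb := (@lebesgue_measure R).
Variables (a b : R).
Hypothesis a0 : 0 < a.
Let phi (x : measurableTypeR R) : measurableTypeR R := a * x + b.

Let mphi : measurable_fun setT phi.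
Proof. by apply: measurable_funD => //; exact: measurable_funM. Qed.

(** The right-hand side is a measure in A, and it agrees with Lebesgue measure
    on intervals. *)
Lemma lebesgue_measure_affine (A : set (measurableTypeR R)) : measurable A ->
  leb A = (a%:E * leb (phi @^-1` A))%E.
Proof.
pose m := mscale (NngNum (ltW a0)) (pushforward leb phi).
move=> mA; rewrite -[RHS]/(m mphi A).
apply: lebesgue_measure_unique => // _ [[c d]] _ <-.
rewrite [RHS](_ : _ = (a%:E * leb `]((c - b) / a)%R, ((d - b) / a)%R]%classic)%E); last first.
  congr (_ * leb _)%E; apply/seteqP; split=> x;
    rewrite /= !in_itv/= /phi ltr_pdivrMr// ler_pdivlMr//;
    by rewrite ltrBlDr lerBrDr mulrC.
rewrite !lebesgue_measure_itv/= !lte_fin ltr_pM2r ?invr_gt0// ltrD2r.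
case: ifPn => _; last by rewrite mule0.
by rewrite -!EFinD -EFinM -mulrBl mulrC divfK ?gt_eqF// opprB addrA subrK.
Qed.

Lemma ge0_integral_affine (D : set (measurableTypeR R)) (f : R -> \bar R) :
  measurable D -> measurable_fun D f -> (forall x, 0 <= f x)%E ->
  (\int[leb]_(x in D) f x =
   a%:E * \int[leb]_(x in phi @^-1` D) f (a * x + b)%R)%E.
Proof.
move=> mD mf f0.
rewrite -(ge0_integral_pushforward mphi leb mD mf); last by move=> x _; exact: f0.
rewrite -(ge0_integral_mscale _ mD (NngNum (ltW a0)))//.
by apply: eq_measure_integral => A mA _; exact: lebesgue_measure_affine.
Qed.
End lebesgue_affine.

(** * Strong measurability in separable spaces *)

Section dense_sequence.
Context {R : realType}.

Lemma separable_dense_seq (E : normedModType R) : separable E ->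
  exists e : nat -> E, forall x (r : R), 0 < r -> exists n, `|x - e n| < r.
Proof.
move=> [D /countable_injP[f finj] Dd].
exists (fun n => xget 0 [set x | D x /\ f x = n]) => x r r0.
have [||z [xz Dz]] := Dd (ball x r).
- by exists x; exact: ballxx.
- exact: ball_open.
exists (f z); rewrite (_ : xget _ _ = z); first by move: xz; rewrite -ball_normE.
by apply: xget_unique => // w [Dw fw]; apply: finj; rewrite ?inE.
Qed.

(** The n-th approximation of u x is the point among 0, e 0, .., e n.-1 that is
    nearest to u x (the first one, in case of a tie). *)
Lemma finite_valued_approximation d (T : measurableType d) (D : set T)
    (E : normedModType R) (u : T -> E) : measurable D -> separable E ->
  (forall v, measurable_fun D (fun x => `|u x - v|)) ->
  exists u_ : nat -> T -> E, [/\ forall n, finite_valued D (u_ n),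
    forall x, u_ n x @[n --> \oo] --> u x &
    forall n x, `|u_ n x| <= 2 * `|u x|].
Proof.
move=> mD /separable_dense_seq[e eP] mu.
pose fix v n : T -> E := if n is m.+1 then
    fun x => if `|u x - e m| < `|u x - v m x| then e m else v m x
  else fun=> 0.
have vlt n x : `|u x - v n.+1 x| <= `|u x - v n x|.
  by rewrite /=; case: ifPn => // /ltW.
have vle n m x : (n <= m)%N -> `|u x - v m x| <= `|u x - v n x|.
  elim: m => [|m IH]; first by rewrite leqn0 => /eqP ->.
  by rewrite leq_eqVlt => /predU1P[->//|/IH]; apply: le_trans.
exists v; split.
- elim=> [|n IH]; first exact: finite_valued_cst.
  have fb : finite_valued D (fun x => `|u x - e n| < `|u x - v n x|).
    split; first exact: finite_finset.
    move=> b; rewrite (_ : _ `&` _ = \bigcup_(w in v n @` D)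
        ((D `&` v n @^-1` [set w]) `&`
         (D `&` [set x | (`|u x - e n| < `|u x - w|) = b]))).
      apply: fin_bigcup_measurable; first exact: IH.1.
      move=> w _; apply: measurableI; first exact: IH.2.
      have mlt : measurable_fun D (fun x => `|u x - e n| < `|u x - w|).
        exact: measurable_fun_ltr.
      exact: (mlt mD [set b]).
    apply/seteqP; split=> [x [Dx /= xb]|x [w _ [[Dx /= <-] [_ /= xb]]]]; last by split.
    by exists (v n x); [exists x|].
  exact: (finite_valued_comp2 (fun (b : bool) w => if b then e n else w) fb IH).
- move=> x; apply/cvgrPdist_lt => r r0; have [n xn] := eP (u x) r r0.
  exists n.+1 => // m /= nm; apply: le_lt_trans (vle _ _ x nm) _ => /=.
  by case: ifPn => //; rewrite -leNgt => /le_lt_trans; apply.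
- move=> n x; rewrite -[v n x](subrK (u x)) mulr2n mulrDl mul1r.
  rewrite (le_trans (ler_normD _ _))// lerD2r distrC (le_trans (vle 0%N _ x _))//.
  by rewrite /= subr0.
Qed.

(** Lower semicontinuous functions are measurable. *)
Lemma open_gt_measurable (f : R -> R) : (forall a, open [set s | a < f s]) ->
  measurable_fun [set: R] f.
Proof.
move=> fo; apply: (measurability _ (RGenOInfty.measurableE R)).
move=> _ [_ [a ->] <-]; rewrite setTI; apply: open_measurable.
by rewrite (_ : _ @^-1` _ = [set s | a < f s])//; apply/seteqP; split=> s /=; rewrite in_itv/= andbT.
Qed.

End dense_sequence.

(** * The variance of a linear form under Q_t *)

Section covariance.
Context {R : realType}.
Add Ring Rr : (sring_theory R).
Variables (E : completeNormedModType R) (S : R -> {lc E -> E}).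
Hypotheses (hS : C0_semigroup S) (hsep : separable E).
Variables (H : completeNormedModType R) (ip : {dot H for idfun}).
Hypothesis hH : hilbert_norm ip.
Variable i : {lc H -> E}.
Local Notation leb := (@lebesgue_measure R).
Implicit Types x y : {lc E -> R^o}.

(** By the Riesz theorem the set from which the adjoint vector is chosen is
    nonempty. *)
Lemma hilbert_adjointE x k : ip (hilbert_adjoint ip i x) k = x (i k).
Proof.
have [h hP] := riesz hH [the {lc H -> R^o} of x \o i].
exact: (xgetPex 0 (ex_intro (fun h => forall k, ip h k = x (i k)) h hP)).
Qed.

Lemma hilbert_adjoint_ext x y : (forall v, x v = y v) ->
  hilbert_adjoint ip i x = hilbert_adjoint ip i y.
Proof.
move=> xy; congr (xget 0 _); apply/seteqP.
by split=> h hP k; rewrite hP xy.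
Qed.

Lemma hilbert_adjoint_norm x : `|hilbert_adjoint ip i x| ^+ 2 = x (Qop ip i x).
Proof. by rewrite -hH hilbert_adjointE. Qed.

Lemma hilbert_adjoint_bound x (C : R) : 0 <= C ->
  (forall k, `|x (i k)| <= C * `|k|) -> `|hilbert_adjoint ip i x| <= C.
Proof.
move=> C0 xC; have [->|h0] := eqVneq (hilbert_adjoint ip i x) 0.
  by rewrite normr0.
rewrite -(@ler_pM2r _ `|hilbert_adjoint ip i x|) ?normr_gt0//.
rewrite -expr2 hilbert_adjoint_norm.
by apply: le_trans (ler_norm _) _; exact: xC.
Qed.

(** By [form_Qt] below, the integral of this function over [0, t] is y (Q_t y). *)
Definition variance_density y (s : R) : R :=
  `|hilbert_adjoint ip i (adjoint (S s) y)| ^+ 2.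

Definition variance_integral (t : R) y : \bar R :=
  (\int[leb]_(s in `[0%R, t]) (variance_density y s)%:E)%E.

Lemma variance_densityE y s :
  y (S s (Qop ip i (adjoint (S s) y))) = variance_density y s.
Proof. by rewrite /variance_density hilbert_adjoint_norm. Qed.

Lemma variance_density_shift y r s : 0 <= r -> 0 <= s ->
  variance_density y (r + s) = variance_density (adjoint (S r) y) s.
Proof.
move=> r0 s0; rewrite /variance_density; congr (`|_| ^+ 2).
by apply: hilbert_adjoint_ext => v /=; rewrite (semigroupD hS).
Qed.

Lemma hilbert_adjoint_semigroup_bound y (t : R) : exists2 C : R, 0 <= C &
  forall s, 0 <= s -> s <= t -> `|hilbert_adjoint ip i (adjoint (S s) y)| <= C.
Proof.
have [M M0 MP] := semigroup_bounded hS t.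
have [A A0 AP] := lc_bound y; have [B B0 BP] := lc_bound i.
exists (A * (M * B)) => [|s s0 st]; first by rewrite !mulr_ge0// ltW.
apply: hilbert_adjoint_bound => [|k]; first by rewrite !mulr_ge0// ltW.
rewrite /= (le_trans (AP _))// -!mulrA ler_pM2l// (le_trans (MP _ _ s0 st))//.
by rewrite ler_pM2l.
Qed.

(** Times are truncated below at 0 so that the covariance curve is defined and
    semicontinuous on the whole line. *)
Lemma dist_max0 (r s : R) : `|Num.max 0 r - Num.max 0 s| <= `|r - s|.
Proof.
wlog rs : r s / r <= s => [hw|].
  by have [/hw//|/ltW/hw] := leP r s; rewrite distrC (distrC s).
rewrite !(distrC r) !(distrC (Num.max 0 r)) !ger0_norm ?subr_ge0//; last first.
  by rewrite ge_max !le_max lexx rs orbT.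
have [r0|r0] := leP 0 r; have [s0|s0] := leP 0 s => //.
- by move: (le_lt_trans r0 (le_lt_trans rs s0)); rewrite ltxx.
- by rewrite lerD2l lerN2 ltW.
- by rewrite subrr subr_ge0.
Qed.

(** The curve s |-> Q S(s)* y is weakly continuous, so that its distance to a
    fixed vector is lower semicontinuous. *)
Lemma dist_covariance_measurable y v : measurable_fun [set: R]
  (fun s : R => `|Qop ip i (adjoint (S (Num.max 0 s)) y) - v|).
Proof.
apply: open_gt_measurable => a; rewrite openE => s /= as_; rewrite /interior.
set w := Qop _ _ _ in as_.
have [z zle zE] := hahn_banach_norming (w - v).
have symQ s' : z (Qop ip i (adjoint (S s') y)) = y (S s' (Qop ip i z)).
  by rewrite -[LHS]hilbert_adjointE ipC hilbert_adjointE.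
have sa0 : 0 < `|w - v| - a by rewrite subr_gt0.
have [C C0 CP] := lc_bound y.
have ps : 0 <= Num.max 0 s by rewrite le_max lexx.
have [d d0 dP] := semigroup_continuous hS (Qop ip i z) ps (divr_gt0 sa0 C0).
apply/nbhs_ballP; exists d => //= r; rewrite -ball_normE /= => sr.
apply: lt_le_trans (zle _); apply: lt_le_trans (ler_norm _).
rewrite linearB/= symQ.
have : `|y (S (Num.max 0 r) (Qop ip i z)) - y (S (Num.max 0 s) (Qop ip i z))|
    < `|w - v| - a.
  rewrite -linearB (le_lt_trans (CP _))// mulrC -ltr_pdivlMr// dP//.
  - by rewrite le_max lexx.
  - by apply: le_lt_trans sr; rewrite distrC; exact: dist_max0.
  - by rewrite subrr normr0.
rewrite -(symQ (Num.max 0 s)) -/w distrC => /(le_lt_trans (ler_norm _)).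
rewrite -zE linearB/= -subr_gt0 => gt0; rewrite -subr_gt0.
move: gt0; congr (0 < _); set a1 := z w; set a2 := z v; set a3 := y _.
by sring R.
Qed.

(** The curve u s = Q S(s)* y is a limit of simple functions u_ n. In S s (u s) the
    time s is replaced by a grid point just below it, which leaves finitely many
    values; joint continuity of the semigroup gives the limit. *)
Lemma covariance_integrand_approx y (t : R) :
  exists (s_ : nat -> R -> E) (M : R),
    [/\ forall n, finite_valued (`[0, t] : set (measurableTypeR R)) (s_ n),
    forall s, `[0, t]%classic s ->
      s_ n s @[n --> \oo] --> S s (Qop ip i (adjoint (S s) y)) &
    forall n s, `[0, t]%classic s -> `|s_ n s| <= M].
Proof.
pose u s := Qop ip i (adjoint (S (Num.max 0 s)) y).
have [|u_ [fu uu ule]] := @finite_valued_approximation R _ (measurableTypeR R)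
  `[0, t]%classic E u (measurable_itv `[0, t]) hsep.
  by move=> v; apply: measurable_funTS; exact: dist_covariance_measurable.
have [C C0 CP] := hilbert_adjoint_semigroup_bound y t.
have [B B0 BP] := lc_bound i; have [M M0 MP] := semigroup_bounded hS t.
pose grid n (k : nat) : R := k%:R / n.+1%:R.
pose kn n (s : R) := Num.truncn (n.+1%:R * s).
have gridle n s : 0 <= s -> grid n (kn n s) <= s.
  move=> s0; rewrite ler_pdivrMr// mulrC.
  by have /andP[] := truncn_itv (mulr_ge0 (ler0n R n.+1) s0).
have gridlt n s : 0 <= s -> `|grid n (kn n s) - s| < n.+1%:R^-1.
  move=> s0; rewrite distrC ger0_norm ?subr_ge0 ?gridle//.
  rewrite ltrBlDl -[X in _ + X]mul1r -mulrDl natr1 ltr_pdivlMr// mulrC.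
  by have /andP[] := truncn_itv (mulr_ge0 (ler0n R n.+1) s0).
exists (fun n s => S (grid n (kn n s)) (u_ n s)), (M * (2 * (B * C))); split.
- move=> n; apply: (finite_valued_comp2 (fun k v => S (grid n k) v)); last exact: fu.
  split.
    apply: (@sub_finite_set _ _ `I_(Num.truncn (n.+1%:R * t)).+1); last exact: finite_II.
    move=> k [s /=]; rewrite in_itv/= => /andP[s0 st] <-.
    by rewrite ltnS; apply: le_truncn; rewrite ler_pM2l.
  move=> k; rewrite (_ : _ `&` _ =
      `[0, t]%classic `&` `[k%:R / n.+1%:R, k.+1%:R / n.+1%:R[%classic).
    by apply: measurableI; exact: measurable_itv.
  apply/seteqP; split=> s [] /=; rewrite !in_itv/= => /andP[s0 st].
    move=> <-; rewrite s0 st; split=> //; rewrite ler_pdivrMr// ltr_pdivlMr//.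
    by rewrite mulrC; exact: truncn_itv (mulr_ge0 _ _).
  rewrite ler_pdivrMr// ltr_pdivlMr// mulrC s0 st => kk; split=> //.
  exact: truncn_def.
- move=> s /=; rewrite in_itv/= => /andP[s0 st]; apply/cvgrPdist_lt => e e0.
  have [d d0 dP] := semigroup_continuous hS (u s) s0 e0.
  have us : u s = Qop ip i (adjoint (S s) y) by rewrite /u max_r.
  rewrite -us; have /cvgrPdist_lt/(_ d d0) := uu s.
  have := @near_infty_natSinv_lt R (PosNum d0).
  apply: filterS2 => n nd un; rewrite distrC; apply: dP.
  + by rewrite divr_ge0.
  + by rewrite (lt_trans (gridlt _ _ s0)).
  + by rewrite distrC.
- move=> n s /=; rewrite in_itv/= => /andP[s0 st].
  rewrite (le_trans (MP _ _ _ _))//; first by rewrite divr_ge0.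
    by rewrite (le_trans (gridle _ _ _)).
  rewrite ler_pM2l// (le_trans (ule _ _))// ler_pM2l// /u max_r//.
  by rewrite (le_trans (BP _))// ler_pM2l// CP.
Qed.

Let mitv (t : R) : measurable (`[0, t] : set (measurableTypeR R)).
Proof. exact: measurable_itv. Qed.

Let leb_itv (t : R) : (leb `[0%R, t]%classic < +oo)%E.
Proof.
by rewrite lebesgue_measure_itv/=; case: ifP => _; rewrite -?EFinB ltry.
Qed.

Lemma measurable_variance_density y t :
  measurable_fun (`[0, t] : set (measurableTypeR R)) (variance_density y).
Proof.
have [s_ [M [fs sf _]]] := covariance_integrand_approx y t.
have := measurable_form (@mitv t) fs sf y.
by apply: eq_measurable_fun => s _; rewrite variance_densityE.
Qed.

(** By the definition of the Hilbert adjoint, y (S s (Q S(s)* y)) is the squared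
    norm of i* S(s)* y. *)
Lemma form_Qt y t : (y (Qt ip i S t y))%:E = variance_integral t y.
Proof.
have [s_ [M [fs sf sM]]] := covariance_integrand_approx y t.
rewrite /Qt -(bochner_integral_form (@mitv t) (leb_itv t) fs sf sM y).
by apply: eq_integral => s _; rewrite variance_densityE.
Qed.

Lemma variance_integral0 y : variance_integral 0 y = 0%E.
Proof.
by rewrite /variance_integral set_itv1 integral_set1.
Qed.

Lemma variance_integralD y s h : 0 <= s -> 0 <= h ->
  (variance_integral (s + h) y =
   variance_integral s y + variance_integral h (adjoint (S s) y))%E.
Proof.
move=> s0 h0; rewrite /variance_integral.
have q0 z r : (0 <= (variance_density z r)%:E)%E by rewrite lee_fin sqr_ge0.
have splitE : `[0, s + h]%classic = `[0, s] `|` `]s, s + h] :> set R.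
  rewrite -itv_bndbnd_setU// ?bnd_simp//.
  by rewrite lerDl.
have mq := measurable_variance_density y (t := s + h).
rewrite splitE ge0_integral_setU//=; first last.
- apply/disj_setPS => r [/=]; rewrite 2!in_itv/= => /andP[_ rs] /andP[].
  by rewrite ltNge rs.
- by rewrite -splitE; apply/measurable_EFinP.
congr (_ + _)%E.
rewrite (@ge0_integral_affine _ 1 s ltr01)//=; last first.
  apply/measurable_EFinP; apply: measurable_funS mq => //.
  by rewrite splitE; exact: subsetUr.
rewrite mul1e (_ : _ @^-1` _ = `]0, h]%classic); last first.
  by apply/seteqP; split=> r /=; rewrite !in_itv/= mul1r ltrDr (addrC r) lerD2l.
rewrite -[RHS]integral_itv_obnd_cbnd//; last first.
  apply/measurable_EFinP.
  apply: measurable_funS (measurable_variance_density _ (t := h)) => //.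
  exact: subset_itv_oc_cc.
apply: eq_integral => r; rewrite inE/= in_itv/= => /andP[r0 _].
by rewrite mul1r addrC variance_density_shift// ltW.
Qed.

Lemma variance_integral_le y (t : R) : exists2 C : R, 0 <= C &
  forall s, 0 <= s -> s <= t -> (variance_integral s y <= (C * s)%:E)%E.
Proof.
have [C C0 CP] := hilbert_adjoint_semigroup_bound y t.
exists (C ^+ 2) => [|s s0 st]; first exact: sqr_ge0.
have -> : (C ^+ 2 * s)%:E = (\int[leb]_(r in `[0%R, s]) (cst (C ^+ 2)%:E r))%E.
  rewrite integral_cst; last exact: measurable_itv.
  rewrite /= lebesgue_measure_itv/= lte_fin sube0.
  by case: ifPn => [//|]; rewrite -leNgt => ss; have -> : s = 0; [apply/eqP; rewrite eq_le ss|rewrite mulr0 mule0].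
apply: ge0_le_integral => //.
- by move=> r _; rewrite lee_fin sqr_ge0.
- by apply/measurable_EFinP; exact: measurable_variance_density.
- move=> r /=; rewrite in_itv/= => /andP[r0 rs]; rewrite lee_fin.
  by rewrite lerXn2r ?nnegrE// CP// (le_trans rs).
Qed.

End covariance.

(** * Centred Gaussian laws on the line *)

Section gaussian_law.
Context {R : realType}.
Add Ring Rr : (sring_theory R).
Local Notation leb := (@lebesgue_measure R).

(** The centred Gaussian law of standard deviation s, the Dirac mass at 0 if
    s = 0. *)
Definition gaussian_law (s : R) : probability (measurableTypeR R) R :=
  if s == 0 then [the probability _ _ of dirac (0 : measurableTypeR R)]
  else [the probability _ _ of normal_prob 0 s].

(** Integration against a law with a density: the Radon-Nikodym derivative is
    almost everywhere the density. *)
Lemma ge0_integral_normal (m s : R) (f : R -> \bar R) :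
  measurable_fun [set: R] f -> (forall x, 0 <= f x)%E ->
  (\int[normal_prob m s]_x f x = \int[leb]_x (f x * (normal_pdf m s x)%:E))%E.
Proof.
move=> mf f0; have dom := normal_prob_dominates m s.
pose nu : {finite_measure set (measurableTypeR R) -> \bar R} :=
  [the {finite_measure set _ -> \bar R} of normal_prob m s].
rewrite -(@Radon_Nikodym_SigmaFinite.change_of_variables _ _ _ nu leb dom)//.
have mp : measurable_fun [set: R] (fun x => (normal_pdf m s x)%:E).
  by apply/measurable_EFinP; exact: measurable_normal_pdf.
have irn := @Radon_Nikodym_SigmaFinite.f_integrable _ _ _ nu leb dom.
apply: ae_eq_integral => //.
- apply: emeasurable_funM => //; exact: (measurable_int leb).
- exact: emeasurable_funM.
- apply: ae_eqe_mul2l => /=; apply: integral_ae_eq => // A _ mA.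
  by rewrite -Radon_Nikodym_SigmaFinite.f_integral.
Qed.

Lemma normal_peakE (s : R) : 0 < s -> normal_peak s = (s * Num.sqrt (pi *+ 2))^-1.
Proof.
move=> s0; rewrite /normal_peak -mulrnAr sqrtrM ?sqr_ge0// sqrtr_sqr.
by rewrite gtr0_norm.
Qed.

(** Completing the square in x. *)
Let quadratic_identity (a b z x : R) : a != 0 -> b != 0 -> a + b != 0 ->
  x ^+ 2 * a^-1 + (z - x) ^+ 2 * b^-1 =
  z ^+ 2 * (a + b)^-1 + (x - a * (a + b)^-1 * z) ^+ 2 * ((a + b) * (a^-1 * b^-1)).
Proof.
move=> a0 b0 c0; have HA := mulfV a0; have HB := mulfV b0; have HC := mulfV c0.
set A := a^-1 in HA *; set B := b^-1 in HB *; set C := (a + b)^-1 in HC *.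
clearbody A B C; clear a0 b0 c0.
set K := (a + b) * (A * B).
have KE : K = A + B.
  have -> : K = (a * A) * B + (b * B) * A by rewrite /K; sring R.
  by rewrite HA HB !mul1r addrC.
have LE : C + a * C * B = B.
  rewrite -[X in X + _](mul1r C) -HB -[RHS]mul1r -HC.
  by sring R.
have ME : a * C * K = B.
  have -> : a * C * K = (a * A) * C + a * C * B by rewrite KE; sring R.
  by rewrite HA mul1r.
have -> : z ^+ 2 * C + (x - a * C * z) ^+ 2 * K =
    z ^+ 2 * C + x ^+ 2 * K - 2 * x * z * (a * C * K) +
    z ^+ 2 * (a * C * (a * C * K)) by sring R.
rewrite ME KE.
have -> : z ^+ 2 * C + x ^+ 2 * (A + B) - 2 * x * z * B + z ^+ 2 * (a * C * B) =
    z ^+ 2 * (C + a * C * B) + x ^+ 2 * (A + B) - 2 * x * z * B by sring R.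
by rewrite LE; sring R.
Qed.

Let divE (u v : R) : - u / (v *+ 2) = - (u * v^-1 * 2^-1).
Proof. by rewrite -(mulr_natr v) invfM mulNr mulrA. Qed.

(** The joint density of X and X + Y, for independent centred Gaussian X and Y, is
    the density of X + Y times the conditional density of X, which is Gaussian. *)
Lemma normal_pdf_mul (s t z x : R) : 0 < s -> 0 < t ->
  let r := Num.sqrt (s ^+ 2 + t ^+ 2) in
  normal_pdf 0 s x * normal_pdf 0 t (z - x) =
  normal_pdf 0 r z * normal_pdf (s ^+ 2 / r ^+ 2 * z) (s * t / r) x.
Proof.
move=> s0 t0 r.
have st0 : 0 < s ^+ 2 + t ^+ 2 by rewrite addr_gt0// exprn_gt0.
have r0 : 0 < r by rewrite sqrtr_gt0.
have th0 : 0 < s * t / r by rewrite divr_gt0// mulr_gt0.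
have r2 : r ^+ 2 = s ^+ 2 + t ^+ 2 by rewrite sqr_sqrtr// ltW.
rewrite !normal_pdfE ?gt_eqF// mulrACA [RHS]mulrACA; congr (_ * _).
  rewrite !normal_peakE// -!invfM; congr (_^-1).
  rewrite mulrACA [RHS]mulrACA; congr (_ * _).
  by rewrite [RHS]mulrC divfK ?gt_eqF//.
rewrite /normal_fun -!expRD; congr expR; rewrite !subr0.
have a0 : s ^+ 2 != 0 by rewrite expf_neq0// gt_eqF.
have b0 : t ^+ 2 != 0 by rewrite expf_neq0// gt_eqF.
have c0 : s ^+ 2 + t ^+ 2 != 0 by rewrite gt_eqF.
have th2 : ((s * t / r) ^+ 2)^-1 =
    (s ^+ 2 + t ^+ 2) * ((s ^+ 2)^-1 * (t ^+ 2)^-1).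
  by rewrite expr_div_n exprMn r2 invf_div invfM.
rewrite !divE th2 r2 -!opprD -!mulrDl.
by rewrite (quadratic_identity z x a0 b0 c0).
Qed.

Let measurable_normal_pdf_comp (m s : R) (f : R * R -> R) :
  measurable_fun [set: R * R] f ->
  measurable_fun [set: R * R] (fun p => (normal_pdf m s (f p))%:E).
Proof.
move=> mf; apply/measurable_EFinP.
exact: (measurableT_comp (measurable_normal_pdf m s) mf).
Qed.

(** By Fubini's theorem the sum of the two variables is integrated last; the
    conditional density of the first one has mass 1. *)
Lemma normal_prob_convolution (s t : R) (F : R -> \bar R) : 0 < s -> 0 < t ->
  measurable_fun [set: R] F -> (forall x, 0 <= F x)%E ->
  (\int[normal_prob 0%R s]_x \int[normal_prob 0%R t]_y F (x + y)%R =
   \int[normal_prob 0%R (Num.sqrt (s ^+ 2 + t ^+ 2)%R)]_z F z)%E.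
Proof.
move=> s0 t0 mF F0; set r := Num.sqrt _.
have mFx x : measurable_fun [set: R] (fun y => F (x + y)).
  by apply: (measurableT_comp mF); exact: measurable_funD.
have mFp : measurable_fun [set: R * R] (fun p : R * R => F p.2).
  exact: (measurableT_comp mF).
pose G (p : R * R) := (F p.2 * (normal_pdf 0 t (p.2 - p.1))%:E *
  (normal_pdf 0 s p.1)%:E)%E.
have p0 (m u x : R) : (0 <= (normal_pdf m u x)%:E)%E by rewrite lee_fin normal_pdf_ge0.
have mG : measurable_fun [set: R * R] G.
  apply: emeasurable_funM; last exact: measurable_normal_pdf_comp.
  apply: emeasurable_funM => //; apply: measurable_normal_pdf_comp.
  exact: measurable_funB.
have G0 p : (0 <= G p)%E by rewrite !mule_ge0.
have mG1 z : measurable_fun [set: R] (fun x => G (x, z)).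
  by apply: (measurableT_comp mG); exact: measurable_pair2.
have mG2 x : measurable_fun [set: R] (fun z => G (x, z)).
  by apply: (measurableT_comp mG); exact: measurable_pair1.
have inner x : (\int[normal_prob 0%R t]_y F (x + y)%R * (normal_pdf 0 s x)%:E =
    \int[leb]_z G (x, z))%E.
  rewrite ge0_integral_normal//.
  rewrite [RHS](@ge0_integral_affine _ 1 x ltr01 setT (fun z => G (x, z)))//; last exact: mG2.
  rewrite preimage_setT mul1e -ge0_integralZr.
  - apply: eq_integral => y _; rewrite /G/= mul1r (addrC y).
    by rewrite [(x + y - x)%R]addrC addKr.
  - exact: measurableT.
  - apply: emeasurable_funM; first exact: mFx.
    by apply/measurable_EFinP; exact: measurable_normal_pdf.
  - by move=> y _; rewrite mule_ge0.
  - exact: p0.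
pose I x := (\int[normal_prob 0%R t]_y F (x + y)%R)%E.
have mI : measurable_fun [set: R] I.
  pose K (p : R * R) := F (p.1 + p.2).
  have mK : measurable_fun [set: R * R] K.
    exact: (measurableT_comp mF (measurable_funD measurable_fst measurable_snd)).
  exact: (@measurable_fun_fubini_tonelli_F _ _ _ _ R (normal_prob 0 t) K mK (fun p => F0 _)).
rewrite -[LHS]/(\int[normal_prob 0%R s]_x I x)%E.
rewrite (@ge0_integral_normal 0 s I)//; last by move=> x; exact: integral_ge0.
transitivity (\int[leb]_x \int[leb]_z G (x, z))%E.
  by apply: eq_integral => x _; exact: inner.
transitivity (\int[leb]_z \int[leb]_x G (x, z))%E.
  exact: (@fubini_tonelli _ _ _ _ R leb leb G mG G0).
rewrite ge0_integral_normal//.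
apply: eq_integral => z _; rewrite /G /=.
transitivity (\int[leb]_x (F z * (normal_pdf 0 r z)%:E *
    (normal_pdf (s ^+ 2 / r ^+ 2 * z) (s * t / r) x)%:E))%E.
  apply: eq_integral => x _; rewrite -!muleA -!EFinM; congr (_ * _%:E)%E.
  by rewrite mulrC normal_pdf_mul.
rewrite ge0_integralZl//.
- by rewrite integral_normal_pdf mule1.
- by apply/measurable_EFinP; exact: measurable_normal_pdf.
- by rewrite mule_ge0.
Qed.

Lemma integral_gaussian_law0 (F : R -> \bar R) : measurable_fun [set: R] F ->
  (\int[gaussian_law 0]_x F x = F 0%R)%E.
Proof.
by move=> mF; rewrite /gaussian_law eqxx integral_dirac// diracT mul1e.
Qed.

(** The Dirac mass at 0 is neutral for convolution, so that the formula persists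
    in the degenerate cases. *)
Lemma gaussian_law_convolution (s t : R) (F : R -> \bar R) : 0 <= s -> 0 <= t ->
  measurable_fun [set: R] F -> (forall x, 0 <= F x)%E ->
  (\int[gaussian_law s]_x \int[gaussian_law t]_y F (x + y)%R =
   \int[gaussian_law (Num.sqrt (s ^+ 2 + t ^+ 2)%R)]_z F z)%E.
Proof.
move=> s0 t0 mF F0.
have mFx x : measurable_fun [set: R] (fun y => F (x + y)).
  by apply: (measurableT_comp mF); exact: measurable_funD.
have [->|t1] := eqVneq t 0.
  rewrite expr0n/= addr0 sqrtr_sqr ger0_norm//.
  by apply: eq_integral => x _; rewrite integral_gaussian_law0// addr0.
have [->|s1] := eqVneq s 0.
  rewrite expr0n/= add0r sqrtr_sqr ger0_norm//.
  rewrite integral_gaussian_law0; first by apply: eq_integral => x _; rewrite add0r.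
  pose K (p : R * R) := F (p.1 + p.2).
  have mK : measurable_fun [set: R * R] K.
    exact: (measurableT_comp mF (measurable_funD measurable_fst measurable_snd)).
  exact: (@measurable_fun_fubini_tonelli_F _ _ _ _ R (gaussian_law t) K mK (fun p => F0 _)).
have s2 : 0 < s by rewrite lt_def s1.
have t2 : 0 < t by rewrite lt_def t1.
have r2 : Num.sqrt (s ^+ 2 + t ^+ 2) != 0.
  by rewrite gt_eqF// sqrtr_gt0 addr_gt0// exprn_gt0.
rewrite /gaussian_law (negbTE s1) (negbTE t1) (negbTE r2).
exact: normal_prob_convolution.
Qed.

Let square_density (s x : R) : \bar R := ((x ^+ 2)%:E * (normal_pdf 0 s x)%:E)%E.

Let square_density_ge0 s x : (0 <= square_density s x)%E.
Proof. by rewrite mule_ge0// lee_fin ?sqr_ge0// normal_pdf_ge0. Qed.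

Let measurable_square_density (s : R) : measurable_fun [set: R] (square_density s).
Proof.
apply: emeasurable_funM; first exact/measurable_EFinP/measurable_funX.
by apply/measurable_EFinP; exact: measurable_normal_pdf.
Qed.

Let ge0_integral_scale (s : R) (g : R -> \bar R) : 0 < s ->
  measurable_fun [set: R] g -> (forall x, 0 <= g x)%E ->
  (\int[leb]_x g x = s%:E * \int[leb]_x g (s * x)%R)%E.
Proof.
move=> s0 mg g0; rewrite (ge0_integral_affine 0 s0 measurableT mg g0).
rewrite preimage_setT; congr (_ * _)%E.
by apply: eq_integral => x _; rewrite addr0.
Qed.

Let square_density_scale (s x : R) : 0 < s ->
  square_density s (s * x) = (s%:E * square_density 1 x)%E.
Proof.
move=> s0; rewrite /square_density -!EFinM; congr EFin.
rewrite !normal_pdfE ?gt_eqF// !normal_peakE// /normal_fun !subr0.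
have -> : - (s * x) ^+ 2 / (s ^+ 2 *+ 2) = - x ^+ 2 / (1 ^+ 2 *+ 2) :> R.
  rewrite !divE exprMn (mulrC (s ^+ 2)) mulfK ?expf_neq0 ?gt_eqF//.
  by rewrite expr1n divr1.
rewrite exprMn mul1r invfM; set e := expR _; set c := (Num.sqrt _)^-1.
have sV : s * s^-1 = 1 by rewrite mulfV ?gt_eqF.
have -> : s ^+ 2 * x ^+ 2 * (s^-1 * c * e) = (s * s^-1) * (s * (x ^+ 2 * (c * e))).
  by sring R.
by rewrite sV mul1r.
Qed.

Let second_moment_scale (s : R) : 0 < s ->
  (\int[leb]_x square_density s x = (s ^+ 2)%:E * \int[leb]_x square_density 1 x)%E.
Proof.
move=> s0; rewrite (ge0_integral_scale s0 (measurable_square_density s) (square_density_ge0 s)).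
under eq_integral do rewrite square_density_scale//.
rewrite (ge0_integralZl leb measurableT (measurable_square_density 1)
  (fun x _ => square_density_ge0 1 x)); last by rewrite lee_fin ltW.
by rewrite muleA -EFinM expr2.
Qed.

(** With u = x ^+ 2 / 8 one has u <= expR u, so that x ^+ 2 times the standard
    density is at most a constant times the density of standard deviation 2. *)
Let second_moment_lty : (\int[leb]_x square_density 1 x < +oo)%E.
Proof.
pose C : R := 8 * (normal_peak 1 / normal_peak 2).
have p2 : 0 < normal_peak 2 :> R by rewrite normal_peak_gt0.
have le x : (square_density 1 x <= C%:E * (normal_pdf 0 2 x)%:E)%E.
  rewrite /square_density -!EFinM lee_fin !normal_pdfE ?gt_eqF//.
  rewrite /C /normal_fun !subr0.
  set e1 := expR _; set e2 := expR _; set a := normal_peak 1; set b := normal_peak 2.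
  have -> : 8 * (a / b) * (b * e2) = a * (8 * e2).
    rewrite -[RHS]mulr1 -(mulVf (lt0r_neq0 p2)) -/b.
    by sring R.
  rewrite mulrCA ler_pM2l ?normal_peak_gt0//.
  pose u := x ^+ 2 / 8.
  have e2E : e2 = expR (- u).
    by rewrite /e2 /u divE -(natrX _ 2 2) -mulrA -invfM -natrM.
  have e1E : e1 <= e2 * e2.
    rewrite e2E -expRD ler_expR /u -opprD -mulrDl divE expr1n divr1 lerN2.
    rewrite -mulr2n -(mulr_natr (x ^+ 2)) -mulrA ler_wpM2l ?sqr_ge0//.
    by rewrite ler_pdivrMr// ler_pdivlMl// -natrM ler_nat.
  have xu : x ^+ 2 = 8 * u by rewrite /u mulrCA divff ?mulr1.
  rewrite xu -mulrA ler_pM2l//; apply: le_trans (ler_wpM2l _ e1E) _.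
    by rewrite divr_ge0// sqr_ge0.
  rewrite mulrA ler_piMl ?expR_ge0// e2E expRN ler_pdivrMr ?expR_gt0// mul1r.
  by rewrite (le_trans _ (expR_ge1Dx _))// lerDr.
apply: (@le_lt_trans _ _ (\int[leb]_x (C%:E * (normal_pdf 0 2 x)%:E))%E).
  apply: ge0_le_integral => //.
    exact: measurable_square_density.
  apply: emeasurable_funM => //.
  by apply/measurable_EFinP; exact: measurable_normal_pdf.
rewrite ge0_integralZl//.
- by rewrite integral_normal_pdf mule1 ltry.
- by apply/measurable_EFinP; exact: measurable_normal_pdf.
- by move=> x _; rewrite lee_fin normal_pdf_ge0.
- by rewrite lee_fin mulr_ge0// divr_ge0// normal_peak_ge0.
Qed.

Let second_moment_gt0 : (0 < \int[leb]_x square_density 1 x)%E.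
Proof.
pose c : R := normal_pdf 0 1 2.
have c0 : 0 < c.
  by rewrite /c normal_pdfE// mulr_gt0// ?normal_peak_gt0// expR_gt0.
apply: (@lt_le_trans _ _ (\int[leb]_(x in `[1%R, 2%R]) (cst c%:E x))%E).
  rewrite integral_cst//= lebesgue_measure_itv/= lte_fin ltr1n/= -EFinB -EFinM lte_fin.
  by rewrite mulr_gt0// subr_gt0 ltr1n.
apply: (@le_trans _ _ (\int[leb]_(x in `[1%R, 2%R]) (square_density 1 x))%E).
  apply: ge0_le_integral => //.
  - by move=> x _; rewrite lee_fin ltW.
  - by apply: measurable_funTS; exact: measurable_square_density.
  - move=> x /=; rewrite in_itv/= => /andP[x1 x2].
    rewrite /square_density -EFinM lee_fin -[leLHS]mul1r.
    apply: ler_pM => //; first exact: ltW.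
      by rewrite -(expr1n _ 2) lerXn2r ?nnegrE// (le_trans _ x1).
    rewrite /c !normal_pdfE// ler_pM2l ?normal_peak_gt0// ler_expR !subr0.
    rewrite !divE lerN2 ler_pM2r// ler_pM2r ?invr_gt0 ?exprn_gt0//.
    by rewrite lerXn2r ?nnegrE// (le_trans _ x1).
apply: ge0_subset_integral => //.
exact: measurable_square_density.
Qed.

(** By scaling. As c > 0, a centred Gaussian law is determined by its second
    moment. *)
Lemma gaussian_law_second_moment : exists2 c : R, 0 < c &
  forall s, 0 <= s -> (\int[gaussian_law s]_x (x ^+ 2)%:E = (c * s ^+ 2)%:E)%E.
Proof.
have m1 : (\int[leb]_x square_density 1 x)%E \is a fin_num.
  by rewrite ge0_fin_numE ?second_moment_lty//; exact: integral_ge0.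
exists (fine (\int[leb]_x square_density 1 x)%E).
  by rewrite fine_gt0// second_moment_gt0.
move=> s; rewrite le_eqVlt => /predU1P[<-|s0].
  rewrite integral_gaussian_law0; last exact/measurable_EFinP/measurable_funX.
  by rewrite expr0n/= mulr0.
rewrite /gaussian_law gt_eqF// ge0_integral_normal//.
- rewrite EFinM fineK// muleC -second_moment_scale//.
- by apply/measurable_EFinP/measurable_funX.
- by move=> x; rewrite lee_fin sqr_ge0.
Qed.

End gaussian_law.

(** * Polynomial approximation of the sign *)

Section sign_polynomials.
Context {R : realType}.
Add Ring Rr : (sring_theory R).

(** Iterating the cubic u |-> (3 * u - u ^+ 3) / 2 drives every nonzero point of
    [-1, 1] to its sign. *)
Definition sign_step (u : R) : R := 2^-1 * (3 * u - u * u * u).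

(** With sg for the iterate, (sg ^+ 2 + sg) / 2 is 1, 0, 0 for sg = 1, 0, -1: the
    limit is the indicator of the positive numbers. *)
Definition positivity_approx (k : nat) (u : R) : R :=
  2^-1 * (iter k sign_step u * iter k sign_step u + iter k sign_step u).

Let half2 : 2^-1 * 2 = 1 :> R. Proof. by rewrite mulVf. Qed.

Lemma sign_step1B (u : R) :
  1 - sign_step u = (1 - u) * (2^-1 * ((1 - u) * (2 + u))).
Proof. by rewrite -{1}half2 /sign_step; sring R. Qed.

Lemma sign_stepN (u : R) : sign_step (- u) = - sign_step u.
Proof. by rewrite /sign_step; sring R. Qed.

Lemma iter_sign_stepN k (u : R) : iter k sign_step (- u) = - iter k sign_step u.
Proof. by elim: k => //= k ->; rewrite sign_stepN. Qed.

Let sign_step_le1 (u : R) : `|u| <= 1 -> sign_step u <= 1.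
Proof.
rewrite ler_norml => /andP[u1 u2]; rewrite -subr_ge0 sign_step1B.
rewrite !mulr_ge0 ?subr_ge0// ?invr_ge0//.
by rewrite -lerBlDl sub0r (le_trans _ u1)// lerN2 ler1n.
Qed.

Lemma iter_sign_step_le1 k (u : R) : `|u| <= 1 -> `|iter k sign_step u| <= 1.
Proof.
move=> u1; elim: k => //= k IH; rewrite ler_norml sign_step_le1// andbT.
by rewrite lerNl -sign_stepN sign_step_le1// normrN.
Qed.

Lemma positivity_approx_le1 k (u : R) : `|u| <= 1 -> `|positivity_approx k u| <= 1.
Proof.
move=> u1; rewrite /positivity_approx normrM ger0_norm ?invr_ge0//.
have := iter_sign_step_le1 k u1; set p := iter _ _ _ => p1.
rewrite mulrC ler_pdivrMr// mul1r (le_trans (ler_normD _ _))//.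
by rewrite [leRHS]mulr2n lerD// normrM mulr_ile1.
Qed.

(** The iterates of a positive u stay above u, and hence each step multiplies the
    distance to 1 by at most 1 - u / 2. *)
Let iter_sign_step_pos (u : R) k : 0 < u -> u <= 1 ->
  u <= iter k sign_step u /\ `|1 - iter k sign_step u| <= (1 - 2^-1 * u) ^+ k.
Proof.
move=> u0 u1; elim: k => [|k [IH1 IH2]] /=.
  split=> //; rewrite expr0 ger0_norm ?subr_ge0// gerDl oppr_le0.
  exact: ltW.
have nu1 : `|u| <= 1 by rewrite gtr0_norm.
have := iter_sign_step_le1 k nu1.
rewrite ler_norml; set p := iter k _ _ in IH1 IH2 * => /andP[_ p1].
have p0 : 0 <= p by rewrite (le_trans _ IH1)// ltW.
split.
  rewrite (le_trans IH1)// -subr_ge0.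
  have -> : sign_step p - p = 2^-1 * (p * ((1 - p) * (1 + p))).
    have -> : sign_step p - p = sign_step p - (2^-1 * 2) * p by rewrite half2 mul1r.
    by rewrite /sign_step; sring R.
  by rewrite !mulr_ge0 ?invr_ge0 ?subr_ge0// addr_ge0.
rewrite sign_step1B normrM exprS mulrC ler_pM//.
have -> : 2^-1 * ((1 - p) * (2 + p)) = 1 - 2^-1 * p - 2^-1 * (p * p).
  by rewrite -[X in _ = X - _ - _]half2; sring R.
rewrite ger0_norm.
  rewrite -addrA lerD2l -opprD lerN2 -mulrDr ler_pM2l ?invr_gt0//.
  by rewrite (le_trans IH1)// lerDl mulr_ge0.
rewrite -[X in X - _ - _]half2 -!mulrBr mulr_ge0 ?invr_ge0//.
by rewrite subr_ge0 lerBrDr [leRHS]mulr2n lerD// mulr_ile1.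
Qed.

Let iter_sign_step_cvg (u : R) : 0 < u -> u <= 1 ->
  iter k sign_step u @[k --> \oo] --> (1 : R).
Proof.
move=> u0 u1; apply/cvgrPdist_le => e e0.
have v1 : `|1 - 2^-1 * u| < 1.
  rewrite ger0_norm ?subr_ge0; first by rewrite gtrDl oppr_lt0 mulr_gt0 ?invr_gt0.
  by rewrite mulr_ile1 ?invr_ge0 ?(ltW u0)// invf_le1// ler1n.
have /cvgrPdist_le/(_ e e0) := cvg_expr v1.
apply: filterS => k; rewrite sub0r normrN => ke.
have [_] := iter_sign_step_pos k u0 u1; move=> /le_trans; apply.
by rewrite (le_trans (ler_norm _)).
Qed.

Lemma positivity_approx_cvg (u : R) : `|u| <= 1 ->
  positivity_approx k u @[k --> \oo] --> (if 0 < u then 1 else 0 : R).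
Proof.
rewrite ler_norml => /andP[u1 u2].
have sgn_cvg : iter k sign_step u @[k --> \oo] --> Num.sg u.
  have [u0|u0|->] := ltgtP u 0.
  - rewrite ltr0_sg// -[u]opprK; under eq_fun do rewrite iter_sign_stepN.
    by apply: cvgN; apply: iter_sign_step_cvg; rewrite ?oppr_gt0// lerNl.
  - by rewrite gtr0_sg//; exact: iter_sign_step_cvg.
  - rewrite sgr0 (_ : (fun k => _) = fun=> 0); first exact: cvg_cst.
    apply/funext; elim=> //= k ->.
    by rewrite /sign_step !mulr0 subrr mulr0.
have -> : (if 0 < u then 1 else 0 : R) = 2^-1 * (Num.sg u * Num.sg u + Num.sg u).
  have [u0|u0|->] := ltgtP u 0.
  - by rewrite ltr0_sg// mulrNN mulr1 subrr mulr0.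
  - by rewrite gtr0_sg// mulr1 mulVf.
  - by rewrite sgr0 !mulr0 addr0 mulr0.
by apply: cvgM; [exact: cvg_cst|apply: cvgD => //; exact: cvgM].
Qed.

End sign_polynomials.

(** * Borel measures and one-dimensional marginals *)

Section borel_functionals.
Context {R : realType}.
Variable E : normedModType R.
Hypothesis hsep : separable E.
Implicit Types y z : {lc E -> R^o}.

Definition half_space (p : {lc E -> R^o} * R) : set E := [set x | p.2 < p.1 x].

Lemma lc_measurable y : measurable_fun [set: borel E] (y : borel E -> measurableTypeR R).
Proof. by apply: continuous_borel_measurable; exact: lc_continuous. Qed.

(** An open set is a countable union of closed balls, and a closed ball is the
    intersection of countably many half-spaces because the norm is the supremum
    of the norming functionals of a dense sequence. *)
Lemma borel_half_spaces :
  @measurable _ (borel E) = <<s range half_space >>.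
Proof.
apply/seteqP; split; last first.
  apply: smallest_sub; first exact: sigma_algebra_measurable.
  move=> _ [[y c] _ <-]; have := lc_measurable y measurableT.
  move=> /(_ `]c, +oo[%classic (measurable_itv _)); rewrite setTI.
  by congr measurable; apply/seteqP; split=> x /=; rewrite in_itv/= andbT.
pose GT := g_sigma_algebraType (range half_space).
apply: smallest_sub; first exact: (@sigma_algebra_measurable _ GT).
move=> U Uo; rewrite -[<<s _ >> U]/(@measurable _ GT U).
have [e eP] := separable_dense_seq hsep.
have /choice[y yP] n : exists y : {lc E -> R^o},
    (forall x, `|y x| <= `|x|) /\ y (e n) = `|e n|.
  by have [y yle yE] := hahn_banach_norming (e n); exists y.
have norm_le x (r : R) : (forall n, y n x <= r) -> `|x| <= r.
  move=> xr; apply/ler_addgt0Pr => d d0.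
  have [n xn] := eP x _ (divr_gt0 d0 (ltr0n R 2)).
  have [yle yE] := yP n.
  have yn : y n (e n) <= r + d / 2.
    rewrite -[X in y n X](subKr x) linearB/= lerD// (le_trans (ler_norm _))//.
    by rewrite normrN (le_trans (yle _))// ltW.
  rewrite -[x in leLHS](subrK (e n)) (le_trans (ler_normD _ _))// -yE.
  by rewrite (le_trans (lerD (ltW xn) yn))// addrCA -splitr.
pose B n (r : R) := [set x | `|x - e n| <= r].
have mB n r : @measurable _ GT (B n r).
  rewrite (_ : B n r = \bigcap_k ~` half_space (y k, r + y k (e n))).
    apply: bigcapT_measurable => k; apply: measurableC.
    by apply: sub_sigma_algebra; exists (y k, r + y k (e n)).
  apply/seteqP; split=> x /= xB.
    move=> k _ /=; apply/negP; rewrite -leNgt -lerBlDr -linearB/=.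
    by rewrite (le_trans (ler_norm _))// (le_trans ((yP k).1 _)).
  apply: norm_le => k; have /negP := xB k I.
  by rewrite -leNgt /= -lerBlDr linearB.
rewrite (_ : U = \bigcup_n \bigcup_k
    if `[< B n k.+1%:R^-1 `<=` U >] then B n k.+1%:R^-1 else set0).
  apply: bigcupT_measurable => n; apply: bigcupT_measurable => k.
  by case: ifP.
apply/seteqP; split=> [x Ux|x [n _ [k _]]]; last first.
  by case: ifPn => // /asboolP; exact.
have /nbhs_ballP[r /= r0 rU] : nbhs x U by exact: open_nbhs_nbhs.
have [k _ kP] := @near_infty_natSinv_lt R (PosNum (divr_gt0 r0 (ltr0n R 2))).
have k0 : 0 < k.+1%:R^-1 :> R by [].
have [n xn] := eP x _ k0.
exists n => //; exists k => //; rewrite ifT; first exact: ltW.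
apply/asboolP => z zB; apply: rU; rewrite -ball_normE /=.
rewrite -(subrKA (e n)) (le_lt_trans (ler_normD _ _))// (splitr r).
have kr := kP k (leqnn k).
by apply: ltrD; [exact: lt_trans xn kr|rewrite distrC (le_lt_trans zB)].
Qed.

(** In a separable space vectors are measurable as soon as their images under
    continuous linear forms are. In particular the sum of two random vectors is
    measurable. *)
Lemma measurable_functionals d (T : measurableType d) (f : T -> borel E) :
  (forall y, measurable_fun [set: T] (fun x => y (f x) : measurableTypeR R)) ->
  measurable_fun [set: T] f.
Proof.
move=> yf; apply: (measurability _ borel_half_spaces).
move=> _ [_ [[y c] _ <-] <-].
have := yf y measurableT `]c, +oo[%classic (measurable_itv _).
by congr (measurable (_ `&` _)); apply/seteqP; split=> x /=; rewrite in_itv/= andbT.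
Qed.

End borel_functionals.

Section characterization.
Context {R : realType}.
Variable E : normedModType R.
Implicit Types y z : {lc E -> R^o}.
Add Ring Rr : (sring_theory R).

(** Real trigonometric polynomials on E; phases make sines superfluous. *)
Inductive trig_poly : (E -> R) -> Prop :=
| trig_poly_cos a y c : trig_poly (fun x => a * cos (y x + c))
| trig_polyD f g : trig_poly f -> trig_poly g -> trig_poly (fun x => f x + g x).

Let form_comb (a b : R) y z : exists w : {lc E -> R^o}, forall x, w x = a * y x + b * z x.
Proof.
have [A A0 AP] := lc_bound y; have [B B0 BP] := lc_bound z.
have [|x|w wP] := @lc_of_linear_bound R E R^o (fun x => a * y x + b * z x)
   (`|a| * A + `|b| * B).
- move=> c u v; rewrite !linearD/= !lc_formZ -![c *: (_ : R^o)]/(c * (_ : R)).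
  by set yu := y u; set yv := y v; set zu := z u; set zv := z v; sring R.
- rewrite mulrDl (le_trans (ler_normD _ _))// !normrM -!mulrA.
  by rewrite lerD// ler_wpM2l.
- by exists w.
Qed.

Let trig_poly_eq (f g : E -> R) : f =1 g -> trig_poly f -> trig_poly g.
Proof. by move=> /funext ->. Qed.

(** Sums and differences of continuous linear forms are such forms, and a product
    of cosines is a sum of cosines. *)
Lemma trig_polyM f g : trig_poly f -> trig_poly g -> trig_poly (fun x => f x * g x).
Proof.
move=> tf tg; elim: tf => [a y c|f1 f2 _ IH1 _ IH2]; last first.
  by apply: trig_poly_eq (trig_polyD IH1 IH2) => x; rewrite mulrDl.
elim: tg => [b z d|f1 f2 _ IH1 _ IH2]; last first.
  by apply: trig_poly_eq (trig_polyD IH1 IH2) => x; rewrite mulrDr.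
have [p pP] := form_comb 1 1 y z; have [m mP] := form_comb 1 (-1) y z.
apply: trig_poly_eq (trig_polyD (trig_poly_cos (2^-1 * a * b) p (c + d))
  (trig_poly_cos (2^-1 * a * b) m (c - d))) => x.
rewrite pP mP !mul1r mulN1r (addrACA (y x) (z x)) (addrACA (y x) (- z x)) -opprD.
rewrite cosD cosB; set u := y x + c; set v := z x + d.
set cu := cos u; set cv := cos v; set su := sin u; set sv := sin v.
have h2 : 2^-1 * 2 = 1 :> R by rewrite mulVf.
have -> : 2^-1 * a * b * (cu * cv - su * sv) + 2^-1 * a * b * (cu * cv + su * sv) =
    2^-1 * 2 * (a * cu * (b * cv)) by sring R.
by rewrite h2 mul1r.
Qed.

Lemma trig_poly_cst (a : R) : trig_poly (fun=> a).
Proof.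
have [||w wP] := @lc_of_linear_bound R E R^o (fun=> 0) 0.
- by move=> c u v; rewrite scaler0 addr0.
- by move=> x; rewrite normr0 mul0r.
- by apply: trig_poly_eq (trig_poly_cos a w 0) => x; rewrite wP addr0 cos0 mulr1.
Qed.

Lemma trig_poly_sin y (a c : R) : trig_poly (fun x => sin (a * (y x - c))).
Proof.
have [w wP] := form_comb a 0 y y.
apply: trig_poly_eq (trig_poly_cos 1 w (- (a * c) - pi / 2)) => x.
by rewrite wP mul0r addr0 mul1r addrA cosBpihalf mulrBr.
Qed.

Lemma trig_poly_positivity_approx f k : trig_poly f ->
  trig_poly (fun x => positivity_approx k (f x)).
Proof.
move=> tf; have ti : trig_poly (fun x => iter k sign_step (f x)).
  elim: k => //= k IH.
  apply: trig_polyM; first exact: trig_poly_cst.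
  apply: (trig_polyD (trig_polyM (trig_poly_cst 3) IH)).
  apply: trig_poly_eq (trig_polyM (trig_poly_cst (-1))
    (trig_polyM (trig_polyM IH IH) IH)) => x.
  by rewrite mulN1r.
apply: trig_polyM; first exact: trig_poly_cst.
by apply: trig_polyD => //; exact: trig_polyM.
Qed.

Lemma trig_poly_prod (I : Type) (s : seq I) (F : I -> E -> R) :
  (forall i, trig_poly (F i)) -> trig_poly (fun x => \prod_(i <- s) F i x).
Proof.
move=> tF; elim: s => [|i s IH].
  by apply: trig_poly_eq (trig_poly_cst 1) => x; rewrite big_nil.
by apply: trig_poly_eq (trig_polyM (tF i) IH) => x; rewrite big_cons.
Qed.

Lemma trig_poly_measurable f : trig_poly f ->
  measurable_fun [set: borel E] (f : borel E -> R).
Proof.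
elim=> [a y c|g h _ mg _ mh]; last exact: measurable_funD.
apply: measurable_funM => //.
apply: measurableT_comp; first by apply: continuous_measurable_fun; exact: continuous_cos.
by apply: measurable_funD => //; exact: lc_measurable.
Qed.

Lemma trig_poly_bounded f : trig_poly f -> exists M : R, forall x, `|f x| <= M.
Proof.
elim=> [a y c|g h _ [M gM] _ [N hN]].
  exists `|a| => x; rewrite normrM ler_piMr// ler_norml cos_geN1 cos_le1//.
by exists (M + N) => x; rewrite (le_trans (ler_normD _ _))// lerD.
Qed.

Section unique.
Variables mu nu : probability (borel E) R.
Hypothesis munu : forall y (A : set (measurableTypeR R)), measurable A ->
  mu (y @^-1` A) = nu (y @^-1` A).

Let bounded_integrable (m : probability (borel E) R) (f : borel E -> R) (M : R) :
  measurable_fun [set: borel E] f -> (forall x, `|f x| <= M) ->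
  m.-integrable [set: borel E] (EFin \o f).
Proof.
move=> mf fM; apply: measurable_bounded_integrable => //.
  by rewrite (le_lt_trans (probability_le1 _ _))// ltry.
exists M; split=> [|N MN x _]; first exact: num_real.
by rewrite /= (le_trans (fM x))// ltW.
Qed.

Lemma trig_poly_integral f : trig_poly f ->
  (\int[mu]_x (f x)%:E = \int[nu]_x (f x)%:E)%E.
Proof.
have TI (m : probability (borel E) R) g : trig_poly g -> m.-integrable [set: borel E] (EFin \o (g : borel E -> R)).
  move=> tg; have [M gM] := trig_poly_bounded tg.
  exact: (bounded_integrable m (trig_poly_measurable tg) gM).
elim=> [a y c|g h tg IHg th IHh]; last first.
  under eq_integral do rewrite EFinD; rewrite integralD//; try exact: TI.
  under [RHS]eq_integral do rewrite EFinD; rewrite integralD//; try exact: TI.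
  by rewrite IHg IHh.
pose g (r : R) := a * cos (r + c).
have mg : measurable_fun [set: R] (fun r => (g r)%:E).
  apply/measurable_EFinP; apply: measurable_funM => //.
  apply: measurableT_comp; first by apply: continuous_measurable_fun; exact: continuous_cos.
  exact: measurable_funD.
have my := lc_measurable y.
have ig (m : probability (borel E) R) : m.-integrable (y @^-1` [set: R]) ((fun r => (g r)%:E) \o (y : borel E -> R)).
  by rewrite preimage_setT; exact: TI (trig_poly_cos a y c).
transitivity (\int[pushforward mu (y : borel E -> measurableTypeR R)]_r (g r)%:E)%E.
  by rewrite (integral_pushforward my mg (ig mu)).
transitivity (\int[pushforward nu (y : borel E -> measurableTypeR R)]_r (g r)%:E)%E.
  by apply: eq_measure_integral => A mA _; exact: munu.
by rewrite (integral_pushforward my mg (ig nu)).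
Qed.

Lemma cvg_integral_eq (f_ : nat -> E -> R) (f : E -> R) :
  (forall n, measurable_fun [set: borel E] (f_ n : borel E -> R)) ->
  (forall n x, `|f_ n x| <= 1) ->
  (forall x, f_ n x @[n --> \oo] --> f x) ->
  (forall n, \int[mu]_x (f_ n x)%:E = \int[nu]_x (f_ n x)%:E)%E ->
  (\int[mu]_x (f x)%:E = \int[nu]_x (f x)%:E)%E.
Proof.
move=> mf f1 ff fmunu.
have h (m : probability (borel E) R) :
    (\int[m]_x (f_ n x)%:E @[n --> \oo] --> \int[m]_x (f x)%:E)%E.
  apply: (@dominated_cvg _ (borel E) R m setT measurableT (fun n x => (f_ n x)%:E)
    (fun x => (f x)%:E) (EFin \o cst 1)).
  - by move=> n; exact/measurable_EFinP.
  - by move=> x _; apply: cvg_EFin; [exact: nearW|exact: ff].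
  - by [].
  - exact: finite_measure_integrable_cst.
  - by move=> n x _; rewrite lee_fin /=.
apply: (cvg_unique _ (h mu)) => //.
by have := h nu; under eq_fun do rewrite -fmunu.
Qed.

Let prod_le1 (I : Type) (s : seq I) (F : I -> R) : (forall i, `|F i| <= 1) ->
  `|\prod_(i <- s) F i| <= 1.
Proof.
move=> F1; elim: s => [|i s IH]; first by rewrite big_nil normr1.
by rewrite big_cons normrM mulr_ile1.
Qed.

Let prod_cvg (I : Type) (s : seq I) (F : nat -> I -> R) (G : I -> R) :
  (forall i, F n i @[n --> \oo] --> G i) ->
  \prod_(i <- s) F n i @[n --> \oo] --> \prod_(i <- s) G i.
Proof.
move=> FG; elim: s => [|i s IH].
  by under eq_fun do rewrite big_nil; rewrite big_nil; exact: cvg_cst.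
by under eq_fun do rewrite big_cons; rewrite big_cons; apply: cvgM.
Qed.

Let positive (u : R) : R := if 0 < u then 1 else 0.

Let positive_le1 u : `|positive u| <= 1.
Proof. by rewrite /positive; case: ifP; rewrite ?normr1 ?normr0. Qed.

Let sin_le1 (u : R) : `|sin u| <= 1.
Proof. by rewrite ler_norml sin_geN1 sin_le1. Qed.

(** sin (u / m) has the sign of u as soon as m > `|u|. *)
Let positive_sin_cvg (u : R) :
  positive (sin (n.+1%:R^-1 * u)) @[n --> \oo] --> positive u.
Proof.
have pos (v : R) n : 0 < v -> v < n.+1%:R -> 0 < sin (n.+1%:R^-1 * v).
  move=> v0 vn; apply: sin2_gt0; rewrite mulr_gt0 ?invr_gt0//=.
  by rewrite mulrC ltr_pdivrMr// (lt_le_trans vn)// ler_peMl// ler1n.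
apply: cvg_near_cst.
near=> n; have un : `|u| < n.+1%:R.
  by near: n; exists (Num.truncn `|u|) => // n /= un; rewrite (lt_le_trans (truncnS_gt _))// ler_nat ltnS.
rewrite /positive; have [u0|u0|<-] := ltgtP 0 u.
- by rewrite pos// (le_lt_trans (ler_norm _)).
- rewrite ltNge ltW// -[u]opprK mulrN sinN oppr_lt0 pos ?oppr_gt0//.
  by rewrite (le_lt_trans (ler_norm _))// normrN.
- by rewrite mulr0 sin0 ltxx.
Unshelve. all: by end_near. Qed.

(** The indicator of u > 0 is first replaced by that of sin (u / n) > 0, which
    tends to it, and then by polynomials in sin (u / n). *)
Lemma integral_positive_prod (s : seq ({lc E -> R^o} * R)) :
  (\int[mu]_x (\prod_(p <- s) positive (p.1 x - p.2))%:E =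
   \int[nu]_x (\prod_(p <- s) positive (p.1 x - p.2))%:E)%E.
Proof.
pose F n x (p : {lc E -> R^o} * R) := sin (n.+1%:R^-1 * (p.1 x - p.2)).
have tF n k : trig_poly (fun x => \prod_(p <- s) positivity_approx k (F n x p)).
  apply: trig_poly_prod => p; apply: trig_poly_positivity_approx.
  exact: trig_poly_sin.
have cF n x : \prod_(p <- s) positivity_approx k (F n x p) @[k --> \oo] -->
    \prod_(p <- s) positive (F n x p).
  by apply: prod_cvg => p; apply: positivity_approx_cvg; exact: sin_le1.
apply: (@cvg_integral_eq (fun n x => \prod_(p <- s) positive (F n x p))).
- move=> n; apply: (@measurable_fun_cvg _ (borel E) R setT
    (fun k x => \prod_(p <- s) positivity_approx k (F n x p))).
    by move=> k; exact: trig_poly_measurable.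
  by move=> x _; exact: cF.
- by move=> n x; apply: prod_le1 => p; exact: positive_le1.
- by move=> x; apply: prod_cvg => p; exact: positive_sin_cvg.
- move=> n; apply: (@cvg_integral_eq
    (fun k x => \prod_(p <- s) positivity_approx k (F n x p))).
  + by move=> k; exact: trig_poly_measurable.
  + by move=> k x; apply: prod_le1 => p; rewrite positivity_approx_le1// sin_le1.
  + by move=> x; exact: cF.
  + by move=> k; exact: trig_poly_integral.
Qed.

(** The one-dimensional marginals determine the integrals of trigonometric
    polynomials, which form an algebra. Indicators of finite intersections of
    half-spaces are iterated bounded limits of such polynomials, and these
    intersections form a pi-system that generates the Borel sets. *)
Lemma marginals_determine : separable E -> forall A, measurable A -> mu A = nu A.
Proof.
move=> hsep A mA.
pose W (s : seq ({lc E -> R^o} * R)) : set (borel E) :=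
  [set x | all (fun p : {lc E -> R^o} * R => p.2 < p.1 (x : E)) s].
pose posW (s : seq ({lc E -> R^o} * R)) (x : E) : R := \prod_(p <- s) positive (p.1 x - p.2).
have posWE s x : posW s x = \1_(W s) (x : borel E).
  rewrite /posW indicE; elim: s => [|p s IH].
    by rewrite big_nil mem_set.
  rewrite big_cons IH /positive subr_gt0.
  have -> : (x \in W (p :: s)) = (p.2 < p.1 x) && (x \in W s).
    apply/idP/idP; rewrite !inE /W /=.
      by move=> /andP[-> xs]; rewrite /= inE.
    by move=> /andP[-> ]; rewrite inE.
  by case: ifP; rewrite ?mul1r ?mul0r.
have mH p : measurable (half_space p : set (borel E)).
  by rewrite (borel_half_spaces hsep); apply: sub_sigma_algebra; exists p.
have mW s : measurable (W s).
  elim: s => [|p s IH]; first by rewrite (_ : W _ = setT)//; apply/seteqP; split.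
  rewrite (_ : W _ = half_space p `&` W s); first exact: measurableI.
  by apply/seteqP; split=> x /=; [move=> /andP[]|move=> [? ?]; apply/andP].
apply: (@measure_unique _ _ (borel E) (range W) (fun=> setT)) => //.
- apply/seteqP; split; last first.
    apply: smallest_sub; first exact: sigma_algebra_measurable.
    by move=> _ [s _ <-].
  rewrite (borel_half_spaces hsep); apply: smallest_sub.
    exact: smallest_sigma_algebra.
  move=> _ [p _ <-]; apply: sub_sigma_algebra; exists [:: p] => //.
  by apply/seteqP; split=> x; rewrite /W /= andbT.
- move=> _ _ [s _ <-] [t _ <-]; exists (s ++ t) => //.
  by apply/seteqP; split=> x; rewrite /W /= all_cat; [move=> /andP[]|move=> [-> ->]].
- by move=> _; exists [::] => //; apply/seteqP; split.
- by rewrite bigcup_const//; exists 0%N.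
- move=> _ [s _ <-].
  have WE (m : probability (borel E) R) :
      (\int[m]_x (posW s x)%:E = m (W s))%E.
    transitivity (\int[m]_x (\1_(W s) x)%:E)%E.
      by apply: eq_integral => x _; rewrite posWE.
    by rewrite integral_indic// setIT.
  exact: (etrans (esym (WE mu)) (etrans (integral_positive_prod s) (WE nu))).
- by move=> _; rewrite (le_lt_trans (probability_le1 _ _))// ltry.
Qed.

End unique.

End characterization.

(** * Tightness of Borel probability measures *)

Section tightness.
Context {R : realType}.

Lemma borel_open (E : ptopologicalType) (U : set E) : open U ->
  measurable (U : set (borel E)).
Proof. exact: sub_sigma_algebra. Qed.

Lemma borel_closed (E : ptopologicalType) (K : set E) : closed K ->
  measurable (K : set (borel E)).
Proof.
move=> cK; rewrite -[K]setCK; apply: measurableC; apply: borel_open.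
exact: closed_openC.
Qed.

Lemma ultra_bigcup (T : Type) (F : set_system T) (B : nat -> set T) N :
  UltraFilter F -> F (\bigcup_(k < N) B k) -> exists2 k, (k < N)%N & F (B k).
Proof.
move=> FU; elim: N => [|N IH] FB.
  exfalso; apply: (@filter_not_empty _ F); apply: filterS FB.
  by move=> x [].
have [FBN|FBN] := in_ultra_setVsetC (B N) FU; first by exists N.
have [|k kN Fk] := IH; last by exists k => //; rewrite ltnW.
have : F (\bigcup_(k < N.+1) B k `&` ~` B N) by exact: filterI.
apply: filterS => x [[k /= kN Bk] nB]; exists k => //=.
move: kN; rewrite ltnS leq_eqVlt => /predU1P[kE|//].
by case: nB; rewrite -kE.
Qed.

(** An ultrafilter on K contains, for each n, one of finitely many balls of radius
    1 / n.+1; hence it is a Cauchy filter. *)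
Lemma closed_totally_bounded_compact (E : completeNormedModType R) (K : set E)
    (e : nat -> E) (N : nat -> nat) : closed K ->
  (forall n x, K x -> exists2 k, (k < N n)%N & `|x - e k| <= n.+1%:R^-1) ->
  compact K.
Proof.
move=> cK KN; rewrite compact_ultra => F FU FK.
have FP : ProperFilter F by exact: ultra_proper.
have : cvg F.
  apply/cauchy_cvgP/cauchyP => r r0.
  have [n _ nr] := @near_infty_natSinv_lt R (PosNum r0).
  have [|k _ Fk] := @ultra_bigcup _ F (fun k => [set x | `|x - e k| <= n.+1%:R^-1]) (N n) FU.
    by apply: filterS FK => x /(KN n)[k kN xk]; exists k.
  exists (e k); apply: filterS Fk => x /= xk.
  rewrite -ball_normE /= distrC (le_lt_trans xk)//.
  exact: (nr n (leqnn n)).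
move=> /cvg_ex[p Fp]; exists p; split=> //.
by apply: (@closed_cvg _ _ F FP id K) => //.
Qed.

(** For each n, finitely many balls of radius 1 / n.+1 around points of a dense
    sequence carry all but r / 2 ^ n.+1 of the mass; the intersection over n of
    these finite unions is closed and totally bounded. *)
Lemma tight_probability (E : completeNormedModType R) (mu : probability (borel E) R)
    (r : R) : separable E -> 0 < r ->
  exists2 K : set E, compact K & (mu (~` K) <= r%:E)%E.
Proof.
move=> /separable_dense_seq[e eP] r0.
pose C n k := [set x : E | n.+1%:R^-1 < `|x - e k|].
have oC n k : open (C n k).
  rewrite (_ : C n k = (fun x => `|x - e k|) @^-1` [set s | n.+1%:R^-1 < s]).
    apply: open_comp; last exact: open_gt.
    move=> x _; apply: cvg_norm.
    by apply: cvgB; [exact: cvg_id|exact: cvg_cst].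
  by [].
pose D n N : set E := \bigcap_(k < N) C n k.
have oD n N : open (D n N).
  elim: N => [|N IH].
    rewrite (_ : D n 0%N = setT); first exact: openT.
    by apply/seteqP; split.
  rewrite (_ : D n N.+1 = D n N `&` C n N); first exact: openI.
  apply/seteqP; split=> [x Dx|x [Dx Cx] k /=].
    by split=> [k kN|]; apply: Dx => //=; rewrite ltnW.
  by rewrite ltnS leq_eqVlt => /predU1P[->//|]; exact: Dx.
have mD n N : measurable (D n N : set (borel E)) by exact: borel_open.
have /choice[N NP] n : exists N, (mu (D n N) <= (r / (2 ^ n.+1)%:R)%:E)%E.
  have q0 : 0 < r / (2 ^ n.+1)%:R by rewrite divr_gt0// ltr0n expn_gt0.
  have DE : \bigcap_N D n N = set0.
    apply/seteqP; split=> // x Dx.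
    have n0 : 0 < n.+1%:R^-1 :> R by [].
    have [k xk] := eP x _ n0.
    have := Dx k.+1 I k (ltnSn k); rewrite /C /= => /(lt_trans xk).
    by rewrite ltxx.
  have : mu \o D n @ \oo --> mu (\bigcap_N D n N).
    apply: nonincreasing_cvg_mu => //.
    - by rewrite (le_lt_trans (probability_le1 _ _))// ltry.
    - by rewrite DE.
    - move=> a b ab; apply/subsetPset => x Dx k /= ka; apply: Dx.
      exact: leq_trans ab.
  rewrite DE measure0 => /fine_cvgP[_ /cvgrPdist_lt/(_ _ q0)[M _ MP]].
  exists M; have := MP M (leqnn M); rewrite /= sub0r normrN => /ltW.
  rewrite ger0_norm ?fine_ge0// -lee_fin fineK//.
  by rewrite ge0_fin_numE// (le_lt_trans (probability_le1 _ _))// ltry.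
pose K : set E := ~` \bigcup_n D n (N n).
exists K.
  apply: (@closed_totally_bounded_compact _ _ e N).
    by apply: open_closedC; apply: bigcup_open => n _; exact: oD.
  move=> n x Kx; apply: contrapT => h; apply: Kx; exists n => // k /= kN.
  by rewrite /C /= ltNge; apply/negP => xk; apply: h; exists k.
rewrite setCK.
have mU : measurable (\bigcup_n D n (N n) : set (borel E)).
  by apply: bigcupT_measurable => n.
apply: le_trans (generalized_Boole_inequality mu (fun n => mD n (N n)) mU) _.
apply: le_trans (epsilon_trick0 xpredT (ltW r0)).
by apply: lee_nneseries => // n _; exact: NP.
Qed.

End tightness.

(** * Images and couplings of probability measures *)

Section probability_lemmas.
Context {R : realType}.

Lemma image_probability d d' (T : measurableType d) (T' : measurableType d')
    (P : probability T R) (phi : T -> T') : measurable_fun [set: T] phi ->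
  exists Q : probability T' R, forall A, Q A = P (phi @^-1` A).
Proof.
move=> mphi.
pose X : {mfun T >-> T'} := HB.pack phi (isMeasurableFun.Build _ _ _ _ phi mphi).
by exists [the probability T' R of distribution P X].
Qed.

Lemma probability_integrable d (T : measurableType d) (P : probability T R)
    (g : T -> R) (M : R) : measurable_fun [set: T] g -> (forall x, `|g x| <= M) ->
  P.-integrable [set: T] (EFin \o g).
Proof.
move=> mg gM; apply: measurable_bounded_integrable => //.
  by rewrite (le_lt_trans (probability_le1 _ _))// ltry.
exists M; split=> [|N MN x _]; first exact: num_real.
by rewrite /= (le_trans (gM x))// ltW.
Qed.

Lemma Rintegral_image d d' (T : measurableType d) (T' : measurableType d')
    (P : probability T R) (Q : probability T' R) (phi : T -> T') (g : T' -> R) (M : R) :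
  measurable_fun [set: T] phi ->
  (forall A, measurable A -> P (phi @^-1` A) = Q A) ->
  measurable_fun [set: T'] g -> (forall x, `|g x| <= M) ->
  \int[Q]_x g x = \int[P]_x g (phi x).
Proof.
move=> mphi PQ mg gM; rewrite /Rintegral; congr fine.
have mg' : measurable_fun [set: T'] (EFin \o g) by exact/measurable_EFinP.
have ig : P.-integrable (phi @^-1` [set: T']) ((EFin \o g) \o phi).
  rewrite preimage_setT.
  exact: (probability_integrable P (measurableT_comp mg mphi) (fun x => gM (phi x))).
transitivity (\int[pushforward P phi]_x (g x)%:E)%E.
  by apply: eq_measure_integral => A mA _; exact/esym/PQ.
by rewrite (integral_pushforward mphi mg' ig measurableT) preimage_setT.
Qed.

(** The difference of the integrands is at most eta + 2 * M * \1_B. *)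
Lemma coupling_bound d (T : measurableType d) (P : probability T R)
    (g1 g2 : T -> R) (M eta eps : R) (B : set T) :
  0 <= eta -> measurable B -> (P B <= eps%:E)%E ->
  measurable_fun [set: T] g1 -> measurable_fun [set: T] g2 ->
  (forall x, `|g1 x| <= M) -> (forall x, `|g2 x| <= M) ->
  (forall x, ~ B x -> `|g1 x - g2 x| <= eta) ->
  `|\int[P]_x g1 x - \int[P]_x g2 x| <= eta + 2 * M * eps.
Proof.
move=> eta0 mB PB mg1 mg2 g1M g2M gB.
have i1 := probability_integrable P mg1 g1M.
have i2 := probability_integrable P mg2 g2M.
have M0 : 0 <= M by apply: le_trans (normr_ge0 _) (g1M point).
have mB1 : measurable_fun [set: T] (\1_B : T -> R) by exact: measurable_indic.
have mbd : measurable_fun [set: T] (fun x => eta + 2 * M * \1_B x).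
  by apply: measurable_funD => //; apply: measurable_funM.
have le x : `|g1 x - g2 x| <= eta + 2 * M * \1_B x.
  rewrite indicE; case: (boolP (x \in B)) => [xB|]; last first.
    by rewrite notin_setE => nB; rewrite mulr0 addr0; exact: gB.
  rewrite mulr1 (le_trans (ler_normB _ _))// mulrDl mul1r.
  by rewrite (le_trans (lerD (g1M x) (g2M x)))// lerDr.
have iB : P.-integrable setT (EFin \o (fun x => eta + 2 * M * \1_B x)).
  apply: (@probability_integrable _ _ _ _ (eta + 2 * M)) => // x.
  have ind0 : 0 <= \1_B x :> R by rewrite indicE.
  rewrite ger0_norm; last by rewrite addr_ge0// mulr_ge0// mulr_ge0.
  by rewrite lerD2l ler_piMr ?mulr_ge0// indicE lern1 leq_b1.
have m12 : measurable_fun [set: T] (fun x => g1 x - g2 x) by exact: measurable_funB.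
have g12M x : `|g1 x - g2 x| <= M + M.
  by rewrite (le_trans (ler_normB _ _))// lerD.
have i12 := probability_integrable P m12 g12M.
have in12 : P.-integrable [set: T] (EFin \o (fun x => `|g1 x - g2 x|)).
  apply: (@probability_integrable _ _ _ _ (M + M)); first exact: measurableT_comp.
  by move=> x; rewrite normr_id.
rewrite -RintegralB//; apply: le_trans (le_normr_Rintegral measurableT i12) _.
apply: (@le_trans _ _ (\int[P]_x (eta + 2 * M * \1_B x))).
  exact: le_Rintegral.
rewrite -lee_fin /Rintegral fineK; last exact: integrable_fin_num.
under eq_integral do rewrite EFinD.
rewrite ge0_integralD//; last 2 first.
- by move=> x _; rewrite lee_fin mulr_ge0 ?mulr_ge0// indicE.
- by apply/measurable_EFinP; apply: measurable_funM.
rewrite integral_cst// [X in (_ * X)%E]probability_setT mule1 EFinD leeD2l//.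
under eq_integral do rewrite EFinM.
rewrite ge0_integralZl//; last 2 first.
- exact/measurable_EFinP.
- by rewrite lee_fin mulr_ge0.
by rewrite integral_indic// setIT [leRHS]EFinM lee_wpmul2l// lee_fin mulr_ge0.
Qed.

End probability_lemmas.

(** * The convolution identity for the Gaussian measures *)

Section gaussian_marginals.
Context {R : realType}.
Variables (E : completeNormedModType R) (S : R -> {lc E -> E}).
Hypotheses (hS : C0_semigroup S) (hsep : separable E).
Variables (H : completeNormedModType R) (ip : {dot H for idfun}).
Hypothesis hH : hilbert_norm ip.
Variable i : {lc H -> E}.
Variable mu : R -> probability (borel E) R.
Hypothesis hmu0 :
  forall A : set (borel E), measurable A -> mu 0 A = dirac ((0 : E) : borel E) A.
Hypothesis hmu : forall t : R, 0 < t ->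
  centred_gaussian (mu t) /\ is_covariance (mu t) (Qt ip i S t).
Implicit Types y : {lc E -> R^o}.

Local Notation variance := (variance_integral S ip i).

Definition has_gaussian_marginal (m : probability (borel E) R) y (s : R) :=
  0 <= s /\ forall A : set (measurableTypeR R), measurable A ->
    m (y @^-1` A) = gaussian_law s A.

Lemma integral_marginal m y s (F : R -> \bar R) :
  has_gaussian_marginal m y s -> measurable_fun [set: R] F ->
  (forall r, 0 <= F r)%E ->
  (\int[m]_x F (y x) = \int[gaussian_law s]_r F r)%E.
Proof.
move=> [_ ms] mF F0; have my := lc_measurable y.
transitivity (\int[pushforward m (y : borel E -> measurableTypeR R)]_r F r)%E.
  by rewrite (ge0_integral_pushforward my m measurableT mF)// preimage_setT.
by apply: eq_measure_integral => A mA _; exact: ms.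
Qed.

(** The second moment of the standard Gaussian law. *)
Let c : R := s2val (cid2 (@gaussian_law_second_moment R)).
Let c0 : 0 < c. Proof. by rewrite /c; case: cid2. Qed.
Let second_moment s : 0 <= s ->
  (\int[gaussian_law s]_x (x ^+ 2)%:E = (c * s ^+ 2)%:E)%E.
Proof. by rewrite /c; case: cid2 => /= a _; apply. Qed.

Lemma marginal_second_moment m y s : has_gaussian_marginal m y s ->
  (\int[m]_x ((y x) ^+ 2)%:E = (c * s ^+ 2)%:E)%E.
Proof.
move=> ms; have := ms => -[s0 _].
rewrite (integral_marginal (F := fun r => (r ^+ 2)%:E) ms) ?second_moment//.
- exact/measurable_EFinP/measurable_funX.
- by move=> r; rewrite lee_fin sqr_ge0.
Qed.

Let scale_inj (a b : R) : 0 <= a -> 0 <= b ->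
  (c * a ^+ 2)%:E = (c * b ^+ 2)%:E -> a = b.
Proof.
move=> a0 b0 [] /(mulfI (lt0r_neq0 c0)) /eqP; rewrite eqrXn2// => /eqP//.
Qed.

(** The second moment of y under mu t is y (Q_t y) by the definition of a
    covariance operator. *)
Lemma gaussian_marginal t y : 0 <= t -> exists2 s, has_gaussian_marginal (mu t) y s &
  variance t y = (c * s ^+ 2)%:E.
Proof.
rewrite le_eqVlt => /predU1P[<-|t0].
  exists 0; last by rewrite variance_integral0 expr0n mulr0.
  split=> // A mA; rewrite /gaussian_law eqxx.
  have mya : measurable ((y : E -> R) @^-1` A : set (borel E)).
    by rewrite -[X in measurable X]setTI; exact: lc_measurable.
  rewrite hmu0//= !diracE /preimage; congr ((nat_of_bool _)%:R%:E).
  by apply/idP/idP; rewrite !inE /= linear0.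
have [+ hcov] := hmu t0; move=> /(_ y)[s s0 sA].
have ms : has_gaussian_marginal (mu t) y s.
  split=> // A mA; rewrite [LHS](sA A mA) /gaussian_law.
  by case: ifP.
exists s => //; rewrite -form_Qt// hcov.
rewrite /Rintegral; under eq_integral do rewrite -expr2.
by rewrite (marginal_second_moment ms).
Qed.

Lemma variance_second_moment t y : 0 <= t ->
  (\int[mu t]_x ((y x) ^+ 2)%:E = variance t y)%E.
Proof. by move=> t0; have [s ms ->] := gaussian_marginal y t0; exact: marginal_second_moment. Qed.

(** The forms y and - y have Gaussian laws with the same second moment, hence the
    same law. *)
Lemma gaussian_symmetric t (A : set (borel E)) : 0 <= t -> measurable A ->
  mu t ((fun x : E => - x) @^-1` A) = mu t A.
Proof.
move=> t0 mA.
have [|nu nuE] := @image_probability R _ _ (borel E) (borel E) (mu t) (fun x : E => - x).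
  apply: measurable_functionals => // y.
  under eq_fun do rewrite linearN.
  exact: measurableT_comp (lc_measurable y).
rewrite -nuE; apply: marginals_determine => // y B mB; rewrite nuE.
have [s ms _] := gaussian_marginal y t0.
have [||w wE] := @lc_of_linear_bound R E R^o (fun x => y (- x)) (s2val (cid2 (lc_bound y))).
- by move=> a u v; rewrite opprD -scalerN linearP.
- by move=> x; case: cid2 => /= M _ MP; rewrite (le_trans (MP _))// normrN.
have [s' ms' _] := gaussian_marginal w t0.
have -> : (fun x : E => - x) @^-1` (y @^-1` B) = w @^-1` B.
  by apply/seteqP; split=> x /=; rewrite wE.
rewrite ms.2// ms'.2//; congr (gaussian_law _ _); apply: scale_inj.
- exact: ms'.1.
- exact: ms.1.
rewrite -(marginal_second_moment ms) -(marginal_second_moment ms').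
by apply: eq_integral => x _; rewrite wE linearN sqrrN.
Qed.

(** The sum X + S(s) Y of p = (Y, X). The increment Y comes first, for this makes
    the product measure an integral over Y of the law of X. *)
Definition shifted_sum (s : R) (p : borel E * borel E) : borel E :=
  (p.2 : E) + S s (p.1 : E).

Lemma measurable_shifted_sum s : measurable_fun [set: borel E * borel E] (shifted_sum s).
Proof.
apply: measurable_functionals => // y.
under eq_fun do rewrite /shifted_sum linearD.
apply: measurable_funD.
  exact: (measurableT_comp (lc_measurable y) measurable_snd).
exact: (measurableT_comp (lc_measurable (adjoint (S s) y)) measurable_fst).
Qed.

(** Under y the two summands are independent centred Gaussian variables, of
    variances y (Q_s y) and z (Q_h z) with z = S(s)* y; by [variance_integralD]
    their sum is y (Q_(s + h) y). *)
Lemma gaussian_skew_convolution s h (A : set (borel E)) : 0 <= s -> 0 <= h -> measurable A ->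
  (mu h \x mu s)%E (shifted_sum s @^-1` A) = mu (s + h) A.
Proof.
move=> s0 h0 mA.
have [nu nuE] := image_probability (mu h \x mu s)%E (measurable_shifted_sum s).
rewrite -nuE; apply: marginals_determine => // y B mB; rewrite nuE.
have [a [a0 ma] va] := gaussian_marginal y s0.
have [b mb vb] := gaussian_marginal (adjoint (S s) y) h0.
have [r [r0 mr] vr] := gaussian_marginal y (addr_ge0 s0 h0).
have rE : r = Num.sqrt (b ^+ 2 + a ^+ 2).
  apply: scale_inj => //.
  rewrite -vr variance_integralD// va vb -EFinD -mulrDr sqr_sqrtr ?addr_ge0 ?sqr_ge0//.
  by rewrite [in RHS]addrC.
rewrite mr// rE.
pose F (u : R) : \bar R := (\1_B u)%:E.
have mF : measurable_fun [set: R] F.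
  by apply/measurable_EFinP; exact: measurable_indic.
have F0 u : (0 <= F u)%E by rewrite lee_fin indicE.
have mFs u : measurable_fun [set: R] (fun v => F (u + v)).
  by apply: (measurableT_comp mF); exact: measurable_funD.
have intF (m : probability (measurableTypeR R) R) : (\int[m]_u F u = m B)%E.
  by rewrite integral_indic// setIT.
rewrite -intF -gaussian_law_convolution//; last exact: mb.1.
pose G u := (\int[gaussian_law a]_v F (u + v)%R)%E.
have mG : measurable_fun [set: R] G.
  pose K (p : R * R) := F (p.1 + p.2).
  have mK : measurable_fun [set: R * R] K.
    exact: (measurableT_comp mF (measurable_funD measurable_fst measurable_snd)).
  exact: (@measurable_fun_fubini_tonelli_F _ _ _ _ R (gaussian_law a) K mK (fun p => F0 _)).
transitivity (\int[mu h]_w G (adjoint (S s) y w))%E; last first.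
  by rewrite (integral_marginal mb mG)// => u; exact: integral_ge0.
rewrite /product_measure1; apply: eq_integral => w _ /=.
have mFw : measurable (((fun v : R => adjoint (S s) y w + v) @^-1` B) : set (measurableTypeR R)).
  rewrite -[X in measurable X]setTI.
  have : measurable_fun [set: measurableTypeR R] (fun v : R => adjoint (S s) y w + v : measurableTypeR R).
    exact: measurable_funD.
  by apply.
transitivity (mu s (y @^-1` ((fun v : R => adjoint (S s) y w + v) @^-1` B))).
  congr (mu s _); apply/seteqP; split=> x; rewrite /xsection /= inE /=;
    by rewrite /shifted_sum/= linearD addrC.
rewrite ma// /G.
rewrite (_ : (fun v => F _) = (fun v => (\1_((fun v : R => adjoint (S s) y w + v) @^-1` B) v)%:E))//.
by rewrite integral_indic// setIT.
Qed.

End gaussian_marginals.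

(** * Uniform tightness and weak continuity *)

Section skew_convolution.
Context {R : realType}.
Add Ring Rr : (sring_theory R).
Variables (E : completeNormedModType R) (S : R -> {lc E -> E}).
Hypotheses (hS : C0_semigroup S) (hsep : separable E).
Variable mu : R -> probability (borel E) R.
Hypothesis mu_convolution : forall s h (A : set (borel E)),
  0 <= s -> 0 <= h -> measurable A ->
  (mu h \x mu s)%E (shifted_sum S s @^-1` A) = mu (s + h) A.
Hypothesis mu_symmetric : forall t (A : set (borel E)), 0 <= t -> measurable A ->
  mu t ((fun x : E => - x) @^-1` A) = mu t A.
Hypothesis mu_variance : forall y : {lc E -> R^o}, exists2 C : R, 0 <= C &
  forall h, 0 <= h -> h <= 1 -> (\int[mu h]_x ((y x) ^+ 2)%:E <= (C * h)%:E)%E.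

Let continuous_measurable_set (f : E -> E) (A : set E) : continuous f ->
  measurable (A : set (borel E)) -> measurable (f @^-1` A : set (borel E)).
Proof.
move=> cf mA.
have mf : measurable_fun [set: borel E] (f : borel E -> borel E).
  apply: (@measurability _ _ (borel E) (borel E) setT f open) => //.
  move=> _ [U Uo <-]; rewrite setTI; apply: borel_open.
  by apply: open_comp => // x _; exact: cf.
by rewrite -[X in measurable X]setTI; exact: mf.
Qed.

(** If X + Y lies in the compact set K with probability near 1, X and Y being
    independent, then so does X + v for some vector v, and by symmetry also
    - X + v; hence X lies in (K - K) / 2. *)
Lemma uniformly_tight (T r : R) : 0 < r -> exists C : set E,
  [/\ compact C, measurable (C : set (borel E)) &
      forall s, 0 <= s -> s <= T -> (mu s (~` C) <= r%:E)%E].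
Proof.
move=> r0; have r4 : 0 < r / 4 by rewrite divr_gt0.
have [K cK KT] := tight_probability (mu T) hsep r4.
pose g (p : E * E) : E := 2^-1 *: (p.1 - p.2).
pose C := g @` (K `*` K).
have cC : compact C.
  apply: continuous_compact; last exact: compact_setX.
  apply: continuous_subspaceT => p; apply: cvgZl_tmp.
  by apply: cvgB; [exact: cvg_fst|exact: cvg_snd].
have closed_compact (B : set E) : compact B -> closed B.
  by apply: compact_closed; exact: norm_hausdorff.
have mC : measurable (C : set (borel E)) by apply: borel_closed; exact: closed_compact.
have mK : measurable (K : set (borel E)) by apply: borel_closed; exact: closed_compact.
exists C; split=> // s s0 sT.
have h0 : 0 <= T - s by rewrite subr_ge0.
have mKC : measurable (~` K : set (borel E)) by exact: measurableC.
pose B (w : E) : set (borel E) := [set x : E | ~ K (x + S s w)].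
have mB w : measurable (B w).
  apply: (@continuous_measurable_set (fun x => x + S s w) (~` K)) => //.
  by move=> x; apply: cvgD; [exact: cvg_id|exact: cvg_cst].
(* The probability of leaving K is an average over w of mu s (B w), so it cannot
   be below r / 2 if every mu s (B w) is at least r / 2. *)
have [w Bw] : exists w, (mu s (B w) < (r / 2)%:E)%E.
  apply: contrapT => hB.
  have : ((r / 2)%:E <= mu T (~` K))%E.
    rewrite -[T in mu T](subrKC s) -mu_convolution//.
    have -> : (r / 2)%:E = (\int[mu (T - s)]_w (cst (r / 2)%:E w))%E.
      by rewrite integral_cst// [X in (_ * X)%E]probability_setT mule1.
    rewrite /product_measure1; apply: ge0_le_integral => //.
    - by move=> w _; rewrite lee_fin divr_ge0// ltW.
    - have := measurable_shifted_sum S hsep s measurableT mKC; rewrite setTI.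
      exact: measurable_fun_xsection.
    - move=> w _ /=; rewrite leNgt; apply/negP => hw; apply: hB; exists w.
      rewrite (_ : B w = xsection (shifted_sum S s @^-1` (~` K)) w)//.
      by apply/seteqP; split=> x; rewrite /xsection /= inE.
  move=> /le_trans /(_ KT); rewrite lee_fin.
  by rewrite ler_pM2l// lef_pV2 ?posrE// ler_nat.
have mBN : measurable ((fun x : E => - x) @^-1` (B w) : set (borel E)).
  by apply: (@continuous_measurable_set (fun x => - x)) => //; exact: oppr_continuous.
apply: (@le_trans _ _ (mu s (B w `|` (fun x : E => - x) @^-1` (B w)))).
  apply: le_measure; rewrite ?inE//.
  - exact: measurableC.
  - exact: measurableU.
  move=> x nCx; apply: contrapT => /not_orP[/contrapT K1 /contrapT K2]; apply: nCx.
  exists (x + S s w, - x + S s w) => //=.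
  rewrite /g /= opprD opprK addrACA subrr addr0 -mulr2n -(scaler_nat 2 x) scalerA.
  by rewrite mulVf// scale1r.
apply: le_trans (measureU2 _ _ _) _ => //.
rewrite [X in (_ + X)%E](mu_symmetric s0 (mB w)) [r in leRHS](splitr r) EFinD.
by apply: leeD; exact: ltW.
Qed.

(** Weak convergence of mu h to the Dirac mass at 0, as h -> 0: by Chebyshev's
    inequality for the one-dimensional marginals and by tightness. *)
Lemma concentration (d r : R) : 0 < d -> 0 < r -> exists2 eta : R, 0 < eta &
  forall h, 0 <= h -> h <= eta -> (mu h [set x : E | (d <= `|x|)%R] <= r%:E)%E.
Proof.
move=> d0 r0; have r2 : 0 < r / 2 by rewrite divr_gt0.
have [C [cC mC Ctight]] := uniformly_tight 1 r2.
have cA : closed [set x : E | d <= `|x|].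
  rewrite (_ : mkset _ = (fun x : E => `|x|) @^-1` [set s | d <= s]); last by [].
  by apply: closed_comp; [move=> x _; apply: cvg_norm; exact: cvg_id|exact: closed_ge].
pose A := [set x : E | d <= `|x|].
have mA : measurable (A : set (borel E)) by exact: borel_closed.
have cAC : compact (C `&` A) by exact: compact_closedI.
have /choice[y yP] x : exists y : {lc E -> R^o},
    (forall z, `|y z| <= `|z|) /\ y x = `|x|.
  by have [y y1 y2] := hahn_banach_norming x; exists y.
pose U x := [set z | d / 2 < `|y x z|].
have oU x : open (U x).
  rewrite (_ : U x = (fun z => `|y x z|) @^-1` [set s | d / 2 < s]); last by [].
  apply: open_comp; last exact: open_gt.
  by move=> z _; apply: cvg_norm; exact: lc_continuous.
have [F _ FU] : finite_subset_cover (C `&` A) U (C `&` A).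
  move: cAC; rewrite compact_cover; apply; first by move=> x _; exact: oU.
  move=> x [Cx Ax]; exists x => //; rewrite /U /= (yP x).2 normr_id.
  by rewrite (lt_le_trans _ Ax)// ltr_pdivrMr// ltr_pMr// ltr1n.
have /choice[k kP] x : exists k : R, 0 <= k /\ forall h, 0 <= h -> h <= 1 ->
    (\int[mu h]_z ((y x z) ^+ 2)%:E <= (k * h)%:E)%E.
  by have [k k0 kP] := mu_variance (y x); exists k.
pose a := (d / 2) ^+ 2.
have a0 : 0 < a by rewrite exprn_gt0// divr_gt0.
have mU x : measurable (U x : set (borel E)) by exact: borel_open.
have chebyshev x h : 0 <= h -> h <= 1 -> (mu h (U x) <= (a^-1 * k x * h)%:E)%E.
  move=> h0 h1; have mfin : mu h (U x) \is a fin_num by exact: fin_num_measure.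
  rewrite -(fineK mfin) lee_fin -mulrA ler_pdivlMl// -lee_fin EFinM fineK//.
  apply: le_trans ((kP x).2 _ h0 h1).
  have my2 : measurable_fun [set: borel E] (fun z : borel E => ((y x z) ^+ 2)%:E).
    by apply/measurable_EFinP; apply: measurable_funX; exact: lc_measurable.
  have := le_integral_abse (mu h) measurableT my2 a0.
  under [in X in _ -> X]eq_integral do rewrite -(@gee0_abs _ (_ ^+ 2)%:E) ?lee_fin ?sqr_ge0//.
  apply: le_trans; rewrite lee_wpmul2l// ?lee_fin ?(ltW a0)//.
  apply: le_measure; rewrite ?inE//.
    apply: emeasurable_fun_c_infty => //.
    exact: measurableT_comp.
  move=> z /= zU; split=> //=; rewrite lee_fin ger0_norm ?sqr_ge0//.
  by rewrite -[leRHS]real_normK ?num_real// lerXn2r ?nnegrE// ltW// divr_gt0.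
have union_bound (s : seq E) h : 0 <= h -> h <= 1 ->
    (mu h (\big[setU/set0]_(x <- s) U x) <= ((\sum_(x <- s) a^-1 * k x) * h)%:E)%E.
  move=> h0 h1; elim: s => [|x s IH]; first by rewrite !big_nil measure0 mul0r.
  rewrite !big_cons mulrDl EFinD.
  apply: le_trans (measureU2 _ _ _) _ => //.
    by apply: bigsetU_measurable => z _.
  by apply: leeD => //; exact: chebyshev.
pose c := \sum_(x <- F) a^-1 * k x.
have c0 : 0 <= c.
  by apply: sumr_ge0 => x _; rewrite mulr_ge0 ?invr_ge0 ?(ltW a0)// (kP x).1.
have c1 : 0 < c + 1 by rewrite ltr_wpDl.
exists (Num.min 1 (r / 2 / (c + 1))); first by rewrite lt_min ltr01 divr_gt0.
move=> h h0; rewrite le_min => /andP[h1 hr].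
have mF : measurable (\big[setU/set0]_(x <- F) U x : set (borel E)).
  by apply: bigsetU_measurable.
apply: (@le_trans _ _ (mu h (~` C `|` \big[setU/set0]_(x <- F) U x))).
  apply: le_measure; rewrite ?inE//.
    by apply: measurableU => //; exact: measurableC.
  move=> x Ax; have [Cx|nCx] := pselect (C x); last by left.
  by right; rewrite -bigcup_seq; exact: FU.
apply: le_trans (measureU2 _ _ _) _ => //; first exact: measurableC.
rewrite [r in leRHS](splitr r) EFinD; apply: leeD; first exact: Ctight.
apply: le_trans (union_bound _ _ h0 h1) _; rewrite lee_fin -/c.
rewrite (le_trans (ler_wpM2l c0 hr))// mulrCA ler_piMr ?(ltW r2)//.
by rewrite ler_pdivrMr// mul1r lerDl.
Qed.

Lemma uniform_shift_continuity (f : E -> R) (C : set E) (z0 : E) (e : R) :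
  continuous (f : E -> R^o) -> compact C -> 0 < e -> exists2 d : R, 0 < d &
  forall x v, C x -> `|v| < d -> `|f (z0 + x + v) - f (z0 + x)| < e.
Proof.
move=> cf cC e0; have e2 : 0 < e / 2 by rewrite divr_gt0.
have : \forall v \near (0 : E), C `<=` [set x | `|f (z0 + x + v) - f (z0 + x)| < e].
  move: cC; rewrite compact_near_coveringP => /(_ E (nbhs (0 : E))
    (fun v x => `|f (z0 + x + v) - f (z0 + x)| < e)); apply.
  move=> x Cx; have /cvgrPdist_lt/(_ _ e2)/nbhs_ballP[d /= d0 dP] := cf (z0 + x).
  have d20 : 0 < d / 2 by rewrite divr_gt0.
  exists (ball x (d / 2), ball (0 : E) (d / 2)) => /=.
    by split; exact: nbhsx_ballx.
  move=> [x' v] /= []; rewrite -!ball_normE /= => xx'; rewrite sub0r normrN => vd.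
  have h1 : `|f (z0 + x) - f (z0 + x' + v)| < e / 2.
    apply: dP; rewrite -ball_normE /= opprD addrA (opprD z0) addrACA subrr add0r.
    by rewrite (le_lt_trans (ler_normB _ _))// (splitr d) ltrD.
  have h2 : `|f (z0 + x) - f (z0 + x')| < e / 2.
    apply: dP; rewrite -ball_normE /= opprD addrACA subrr add0r.
    by rewrite (lt_le_trans xx')// ler_pdivrMr// ler_peMr ?(ltW d0)// ler1n.
  rewrite -(subrKA (f (z0 + x))) (le_lt_trans (ler_normD _ _))// (splitr e).
  by rewrite ltrD// distrC.
move=> /nbhs_ballP[d /= d0 dP]; exists d => // x v Cx vd.
by apply: dP => //; rewrite -ball_normE /= sub0r normrN.
Qed.

(** mu (s + h) is the law of X + S(s) Y with X of law mu s and Y of law mu h; as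
    h -> 0, Y tends to 0 in probability, uniformly in s. *)
Lemma integral_translate_continuity (f : Cb E) (z0 : E) (T e : R) : 0 < e ->
  exists2 d : R, 0 < d & forall s h z z', 0 <= s -> 0 <= h -> h < d -> s + h <= T ->
    `|z - z0| < d -> `|z' - z0| < d ->
    `|\int[mu s]_(x in [set: borel E]) f (z + (x : E)) -
      \int[mu (s + h)]_(x in [set: borel E]) f (z' + (x : E))| <= e.
Proof.
move=> e0; have /asboolP[cf /bounded_funE[M fM]] := Cb_prop f.
have M0 : 0 <= M by apply: le_trans (fM 0).
have M1 : 0 < M + 1 by rewrite ltr_wpDl.
(* Two exceptional events of probability at most r, on which the integrands
   differ by at most 2 * M, contribute at most e / 2. *)
pose r := e / 8 / (M + 1).
have r0 : 0 < r by rewrite !divr_gt0.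
have e4 : 0 < e / 4 by rewrite divr_gt0.
have [C [cC mC Ctight]] := uniformly_tight T r0.
have [d1 d10 d1P] := uniform_shift_continuity z0 cf cC e4.
have d12 : 0 < d1 / 2 by rewrite divr_gt0.
have [A A0 AP] := semigroup_bounded hS T.
pose dw := d1 / 2 / A.
have dw0 : 0 < dw by rewrite divr_gt0.
have [eta eta0 etaP] := concentration dw0 r0.
exists (Num.min (d1 / 2) eta); first by rewrite lt_min d12.
move=> s h z z' s0 h0; rewrite !lt_min => /andP[_ heta] shT /andP[zd _] /andP[z'd _].
have sT : s <= T by rewrite (le_trans _ shT)// lerDl.
pose P : probability (borel E * borel E)%type R :=
  [the probability _ _ of (mu h \x mu s)%E].
have mfz u : measurable_fun [set: borel E] (fun x : borel E => f (u + (x : E)) : R).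
  apply: (@continuous_borel_measurable _ _ (fun x => f (u + x))) => x.
  apply: continuous_comp; last exact: cf.
  by apply: cvgD; [exact: cvg_cst|exact: cvg_id].
have mS := measurable_shifted_sum S hsep s.
have msnd : measurable_fun [set: borel E * borel E] (snd : borel E * borel E -> borel E).
  exact: measurable_snd.
have Psnd (B : set (borel E)) : measurable B -> P (snd @^-1` B) = mu s B.
  move=> mB; rewrite (_ : snd @^-1` B = setT `*` B); last first.
    by apply/seteqP; split=> [[u v] //|[u v] []].
  by rewrite /P/= product_measure1E// [X in (X * _)%E]probability_setT mul1e.
rewrite (@Rintegral_image _ _ _ _ _ P (mu s) snd (fun x => f (z + (x : E))) M)//.
rewrite (@Rintegral_image _ _ _ _ _ P (mu (s + h)) (shifted_sum S s)
  (fun x => f (z' + (x : E))) M)//; last by move=> B mB; exact: mu_convolution.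
pose W : set (borel E) := [set x : E | dw <= `|x|].
have mW : measurable W.
  apply: borel_closed; rewrite (_ : W = (fun x : E => `|x|) @^-1` [set t | dw <= t])//.
  by apply: closed_comp; [move=> x _; apply: cvg_norm; exact: cvg_id|exact: closed_ge].
pose C' : set (borel E) := ~` C.
have mC' : measurable C' by exact: measurableC.
pose B1 : set (borel E * borel E) := [set: borel E] `*` C'.
pose B2 : set (borel E * borel E) := W `*` [set: borel E].
pose B := B1 `|` B2.
have mB1 : measurable B1 by exact: measurableX.
have mB2 : measurable B2 by exact: measurableX.
have mB : measurable B by exact: measurableU.
have PB : (P B <= (r + r)%:E)%E.
  apply: le_trans (measureU2 _ mB1 mB2) _; rewrite EFinD; apply: leeD.
    rewrite /P/= product_measure1E// [X in (X * _)%E]probability_setT mul1e.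
    exact: Ctight.
  rewrite /P/= product_measure1E// [X in (_ * X)%E]probability_setT mule1.
  by apply: etaP => //; exact: ltW.
apply: (@le_trans _ _ (e / 4 + e / 4 + 2 * M * (r + r))); last first.
  pose q := e / 8; have eq8 : e = q * 8 by rewrite divfK.
  have e4E : e / 4 = 2 * q.
    by rewrite -[RHS](@mulfK _ 4)//; congr (_ / _); rewrite [LHS]eq8; sring R.
  have Mr : 0 <= q - M * r.
    rewrite subr_ge0 /r mulrCA ler_piMr ?divr_ge0 ?(ltW e0)//.
    by rewrite ler_pdivrMr// mul1r lerDl.
  rewrite e4E -subr_ge0 [X in X - _]eq8.
  have := mulr_ge0 (ler0n R 4) Mr; congr (0 <= _).
  by sring R.
apply: (@coupling_bound _ _ _ P _ _ M _ (r + r) B) => //.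
- by rewrite addr_ge0// ltW.
- exact: (measurableT_comp (mfz z) msnd).
- exact: (measurableT_comp (mfz z') mS).
move=> [w x] nB; have Cx : C x by apply: contrapT => nC; apply: nB; left.
have wd : `|w : E| < dw by rewrite ltNge; apply/negP => dww; apply: nB; right.
have close u : `|u| < d1 -> `|f (z0 + (x : E)) - f (z0 + (x : E) + u)| <= e / 4.
  by move=> ud; rewrite distrC ltW// d1P.
rewrite /shifted_sum /=.
have zE : z + (x : E) = z0 + (x : E) + (z - z0).
  by rewrite [RHS]addrC subrKA.
have z'E : z' + ((x : E) + S s w) = z0 + (x : E) + (z' - z0 + S s w).
  by rewrite [RHS]addrC addrAC subrKA addrA.
rewrite zE z'E -(subrKA (f (z0 + (x : E)))) (le_trans (ler_normD _ _))// lerD//.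
  rewrite distrC close// (lt_le_trans zd)// ler_pdivrMr//.
  by rewrite ler_peMr ?(ltW d10)// ler1n.
apply: close; rewrite (le_lt_trans (ler_normD _ _))// (splitr d1) ltrD//.
by rewrite (le_lt_trans (AP _ _ s0 sT))// mulrC -ltr_pdivlMr.
Qed.

End skew_convolution.

(** * Strong continuity in the mixed topology *)

Section mixed_convergence.
Context {R : realType}.
Variable E : normedModType R.

(** On a norm-bounded set the mixed topology is that of uniform convergence on
    compact sets. *)
Lemma mixed_topology_cvg (F : set_system (Cb E)) (f : Cb E) (M : R) : Filter F ->
  (forall x, `|f x| <= M) -> F [set g : Cb E | forall x, `|g x| <= M] ->
  F --> (f : compact_convergence E) -> F --> (f : mixed_topology E).
Proof.
move=> FF fM FM Ff U; rewrite /= nbhsE => -[U' [U'o U'f] U'U].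
pose B := [set g : Cb E | forall x, `|g x| <= M].
have nB : norm_bounded B.
  exists M => g gM; rewrite /supnorm; apply: ge_sup.
    by exists `|g 0|, 0.
  by move=> _ [x _ <-]; exact: gM.
have [_ /(_ _ nB) agree] := mixed_topology_candidate E.
have : [set V `&` B | V in @open (mixed_topology E)] (U' `&` B) by exists U'.
rewrite agree => -[V Vo VU].
have [Vf _] : (V `&` B) f by rewrite VU.
have FV : F V by apply: Ff; exact: open_nbhs_nbhs.
rewrite nbhs_filterE; apply: filterS2 FV FM => g Vg Bg; apply: U'U.
by have [] : (U' `&` B) g by rewrite -VU.
Qed.

End mixed_convergence.

Section ou_continuity.
Context {R : realType}.
Variables (E : completeNormedModType R) (S : R -> {lc E -> E}).
Hypotheses (hS : C0_semigroup S).
Variable mu : R -> probability (borel E) R.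
Hypothesis mu_translate : forall (f : Cb E) (z0 : E) (T e : R), 0 < e ->
  exists2 d : R, 0 < d & forall s h z z', 0 <= s -> 0 <= h -> h < d -> s + h <= T ->
    `|z - z0| < d -> `|z' - z0| < d ->
    `|\int[mu s]_(x in [set: borel E]) f (z + (x : E)) -
      \int[mu (s + h)]_(x in [set: borel E]) f (z' + (x : E))| <= e.

(** P(t) f x is the integral of f (S t x + v) in v against mu t, and S t x is
    near S t0 x0; the smaller of the two times t and t0 plays the part of s, and
    their distance that of h. *)
Lemma ou_semigroup_joint_continuity (f : Cb E) (t0 : R) (x0 : E) (e : R) :
  0 <= t0 -> 0 < e -> exists2 d : R, 0 < d & forall t x, 0 <= t ->
    `|t - t0| < d -> `|x - x0| < d ->
    `|ou_semigroup S mu t f x - ou_semigroup S mu t0 f x0| <= e.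
Proof.
move=> t00 e0.
have [d d0 dP] := mu_translate f (S t0 x0) (t0 + 1) e0.
have [d' d'0 d'P] := semigroup_continuous hS x0 t00 d0.
exists (Num.min 1 (Num.min d d')); first by rewrite !lt_min ltr01 d0.
move=> t x tge0; rewrite !lt_min => /and3P[t1 td td'] /and3P[_ _ xd'].
have near_z : `|S t x - S t0 x0| < d by exact: d'P.
have near_z0 : `|S t0 x0 - S t0 x0| < d by rewrite subrr normr0.
have [tt|/ltW tt] := leP t0 t.
  rewrite distrC; have := dP t0 (t - t0) (S t0 x0) (S t x).
  rewrite subrKC; apply=> //; rewrite ?subr_ge0//.
    by rewrite (le_lt_trans (ler_norm _)).
  by rewrite -lerBlDl (le_trans (ler_norm _))// ltW.
have := dP t (t0 - t) (S t x) (S t0 x0).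
rewrite subrKC; apply=> //; rewrite ?subr_ge0//.
  by rewrite (le_lt_trans (ler_norm _))// distrC.
by rewrite lerDl.
Qed.

Lemma ou_semigroup_bound (f : Cb E) (M t : R) x : (forall x, `|f x| <= M) ->
  `|ou_semigroup S mu t f x| <= M.
Proof.
move=> fM; have /asboolP[cf _] := Cb_prop f.
have M0 : 0 <= M by apply: le_trans (fM 0).
have mf : measurable_fun [set: borel E] (fun y : borel E => f (S t x + (y : E)) : R).
  apply: (@continuous_borel_measurable _ _ (fun y => f (S t x + y))) => y.
  apply: continuous_comp; last exact: cf.
  by apply: cvgD; [exact: cvg_cst|exact: cvg_id].
have := @coupling_bound R _ _ (mu t) (fun y : borel E => f (S t x + (y : E)))
  (cst 0) M M 0 set0 M0 measurable0.
rewrite measure0 mulr0 addr0 Rintegral_cst// mul0r subr0; apply=> //.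
  by move=> y; rewrite /= normr0.
by move=> y _; rewrite subr0.
Qed.

(** Joint continuity gives, for each x, neighbourhoods of x and of t0 on which
    P(t) f varies little; finitely many of the former cover a compact set. *)
Lemma ou_semigroup_mixed_continuous (f : Cb E) :
  {within `[0, +oo[, continuous
    ((fun t : R => ou_semigroup S mu t f) : R -> mixed_topology E)}.
Proof.
have /asboolP[_ /bounded_funE[M fM]] := Cb_prop f.
apply/subspace_continuousP => t0 /=; rewrite in_itv/= andbT => t00.
apply: (@mixed_topology_cvg _ _ _ _ M).
- by move=> x; exact: (@ou_semigroup_bound f M t0 x fM).
- by apply: nearW => t _ x; exact: (@ou_semigroup_bound f M t x fM).
apply: (proj2 (@compact_convergence_cvgP _ _ _ (ou_semigroup S mu t0 f) _)) => K e cK e0.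
have e2 : 0 < e / 2 by rewrite divr_gt0.
have e4 : 0 < e / 2 / 2 by rewrite divr_gt0.
move: cK; rewrite compact_near_coveringP => /(_ R (within `[0, +oo[%classic (nbhs t0))
  (fun t x => `|ou_semigroup S mu t0 f x - ou_semigroup S mu t f x| < e)); apply.
move=> x Kx.
have [d d0 dP] := ou_semigroup_joint_continuity f x t00 e4.
exists (ball x d, [set t | 0 <= t /\ `|t - t0| < d]) => /=.
  split; first exact: nbhsx_ballx.
  apply/nbhs_ballP; exists d => //= t; rewrite -ball_normE /= => td.
  by rewrite in_itv/= andbT => t_ge0; rewrite distrC.
move=> [x' t] /= []; rewrite -ball_normE /= distrC => x'd [tge0 td].
have near_t0 := dP t0 x' t00 (_ : `|t0 - t0| < d) x'd.
rewrite -(subrKA (ou_semigroup S mu t0 f x)) (le_lt_trans (ler_normD _ _))//.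
rewrite [ltRHS](splitr e) ltr_leD//.
  apply: (le_lt_trans (near_t0 _)); first by rewrite subrr normr0.
  by rewrite ltr_pdivrMr// ltr_pMr// ltr1n.
rewrite distrC (le_trans (dP _ _ tge0 td x'd))//.
by rewrite ler_pdivrMr// ler_peMr ?(ltW e2)// ler1n.
Qed.

End ou_continuity.

Theorem theorem6p2 (R : realType) (E : completeNormedModType R)
  (S : R -> {lc E -> E}) (hS : C0_semigroup S)
  (H : completeNormedModType R) (ip : {dot H for idfun})
  (hH : hilbert_norm ip) (i : {lc H -> E}) (hi : injective i)
  (hsep : separable E)
  (mu : R -> probability (borel E) R)
  (hmu0 : forall A : set (borel E), measurable A -> mu 0 A = dirac ((0 : E) : borel E) A)
  (hmu : forall t : R, 0 < t ->
    centred_gaussian (mu t) /\ is_covariance (mu t) (Qt ip i S t)) :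
  forall f : Cb E,
    {within `[0, +oo[, continuous
      ((fun t : R => ou_semigroup S mu t f) : R -> mixed_topology E)}.
Proof.
move=> f; apply: (ou_semigroup_mixed_continuous hS).
apply: (integral_translate_continuity hS hsep).
- by move=> s h A s0 h0 mA; apply: (gaussian_skew_convolution hS hsep hH hmu0 hmu).
- by move=> t A t0 mA; apply: (gaussian_symmetric hS hsep hH hmu0 hmu).
move=> y; have [C C0 CP] := variance_integral_le hS hsep hH i y 1.
exists C => // h h0 h1.
by rewrite (variance_second_moment hS hsep hH hmu0 hmu y h0); exact: CP.
Qed.
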